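(* Let $G$ be a connected, compact Lie group of odd dimension $2k+1$ with Lie algebra $\mathfrak g$ and complexification $\mathfrak g_{\mathbb C}=\mathfrak g\otimes_{\mathbb R}\mathbb C$. Let $\mathfrak v\subset\mathfrak g_{\mathbb C}$ be an elliptic structure of minimal rank, i.e. a complex Lie subalgebra with $\mathfrak v+\overline{\mathfrak v}=\mathfrak g_{\mathbb C}$ and $\dim_{\mathbb C}\mathfrak v=k+1$. Then there exists a maximal abelian subalgebra $\mathfrak t\subset\mathfrak g$ such that, setting $\mathfrak e=\mathfrak v\cap\mathfrak t_{\mathbb C}$, one has $$\mathfrak v=\mathfrak e\oplus\mathfrak b_{\mathfrak t},\qquad \mathfrak b_{\mathfrak t}=\bigoplus_{\alpha\in\Delta_+}\mathfrak g_\alpha,$$ for some system of positive roots $\Delta_+$ of $\mathfrak t_{\mathbb C}$ in $\mathfrak g_{\mathbb C}$, where $\mathfrak e\subset\mathfrak t_{\mathbb C}$ is an elliptic subalgebra of minimal rank in $\mathfrak t_{\mathbb C}$.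
   Context: Bars denote complex conjugation of $\mathfrak g_{\mathbb C}$ with respect to $\mathfrak g$. For a maximal abelian subalgebra $\mathfrak t\subset\mathfrak g$, $\mathfrak t_{\mathbb C}=\mathfrak t\otimes\mathbb C$; $\Delta$ is the set of (nonzero) roots of $\mathfrak t_{\mathbb C}$ in $\mathfrak g_{\mathbb C}$, and $\mathfrak g_\alpha$ is the (one-dimensional) root space of $\alpha\in\Delta$. A system of positive roots is a subset $\Delta_+\subset\Delta$ such that for each $\alpha\in\Delta$ exactly one of $\alpha,-\alpha$ lies in $\Delta_+$, and for any distinct $\alpha,\beta\in\Delta_+$ with $\alpha+\beta\in\Delta$ one has $\alpha+\beta\in\Delta_+$. Since $\dim G$ is odd, $\dim\mathfrak t$ is odd, say $\dim_{\mathbb R}\mathfrak t=2r+1$; a subalgebra (subspace) $\mathfrak e\subset\mathfrak t_{\mathbb C}$ is elliptic of minimal rank in $\mathfrak t_{\mathbb C}$ if $\mathfrak e+\overline{\mathfrak e}=\mathfrak t_{\mathbb C}$ and $\dim_{\mathbb C}\mathfrak e=r+1$. *)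

(* Defs.v *)
From HB Require Import structures.
From mathcomp Require Import all_boot all_order all_algebra.
From mathcomp Require Import all_classical all_reals all_analysis.
From mathcomp Require Import complex.

Set Implicit Arguments.
Unset Strict Implicit.
Unset Printing Implicit Defensive.

Import Order.TTheory GRing.Theory Num.Theory numFieldNormedType.Exports.

Local Open Scope classical_set_scope.
Local Open Scope ring_scope.

(* [f] is C^k on the open set [U]: by induction on [k], all its iterated
   directional derivatives of order at most [k] exist and are continuous. *)
Fixpoint Ck (R : realType) (V W : normedModType R) (k : nat) (U : set V)
    (f : V -> W) : Prop :=
  (forall x, U x -> {for x, continuous f}) /\
  if k is k'.+1 then
    forall v : V, (forall x, U x -> derivable f x v) /\ Ck k' U ('D_v f)
  else True.

Definition smooth_on (R : realType) (V W : normedModType R) (U : set V)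
    (f : V -> W) : Prop :=
  forall k : nat, Ck k U f.

(* The functions [chart_map] and [chart_inv] are total; only their values on
   [chart_dom] and on its image are meaningful. *)
Record chart (R : realType) (n : nat) (M : topologicalType) := Chart {
  chart_dom : set M;
  chart_map : M -> 'rV[R]_n;
  chart_inv : 'rV[R]_n -> M;
  chart_im := chart_map @` chart_dom;
  chart_dom_open : open chart_dom;
  chart_im_open : open chart_im;
  chart_mapK : forall x, chart_dom x -> chart_inv (chart_map x) = x;
  chart_map_continuous : forall x, chart_dom x -> {for x, continuous chart_map};
  chart_inv_continuous : forall p, chart_im p -> {for p, continuous chart_inv}
}.

Arguments chart_im {R n M} c _.

HB.mixin Record isLieGroup (R : realType) (n : nat) G
    of Topological G & Group G := {
  lie_hausdorff : hausdorff_space G;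
  lie_second_countable : @second_countable G;
  atlas : set (chart R n G);
  atlas_cover : forall x : G, exists2 phi, atlas phi & chart_dom phi x;
  atlas_compat : forall phi psi, atlas phi -> atlas psi ->
    smooth_on [set p | chart_im phi p /\ chart_dom psi (chart_inv phi p)]
      (chart_map psi \o chart_inv phi);
  lie_mul_continuous : continuous (fun xy : G * G => (xy.1 * xy.2)%g);
  lie_mul_smooth : forall phi chi psi, atlas phi -> atlas chi -> atlas psi ->
    smooth_on
      [set p : 'rV[R]_n * 'rV[R]_n | [/\ chart_im phi p.1, chart_im chi p.2
         & chart_dom psi (chart_inv phi p.1 * chart_inv chi p.2)%g]]
      (fun p => chart_map psi (chart_inv phi p.1 * chart_inv chi p.2)%g);
  lie_inv_continuous : continuous (fun x : G => x^-1%g);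
  lie_inv_smooth : forall phi psi, atlas phi -> atlas psi ->
    smooth_on
      [set p | chart_im phi p /\ chart_dom psi (chart_inv phi p)^-1%g]
      (fun p => chart_map psi (chart_inv phi p)^-1%g)
}.

(* Real Lie groups of dimension [n]. *)
#[short(type="lieGroupType")]
HB.structure Definition LieGroup (R : realType) (n : nat) :=
  { G of isLieGroup R n G & Topological G & Group G }.

Section LieAlgebraOfLieGroup.
Variables (R : realType) (n : nat) (G : lieGroupType R n) (phi : chart R n G).
Local Notation g := 'rV[R]_n.

(* Given a chart [phi] at the identity, T_1 G is identified with R^n, and
   [left_inv_field X] is the expression in [phi] of the left-invariant vector
   field x |-> d(L_x)_1 X. *)
Definition left_inv_field (X : g) : g -> g := fun p =>
  'D_X (fun q => chart_map phi (chart_inv phi p * chart_inv phi q)%g)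
    (chart_map phi 1%g).

Definition field_bracket (V W : g -> g) : g -> g := fun p =>
  'D_(V p) W p - 'D_(W p) V p.

Definition lie_bracket (X Y : g) : g :=
  field_bracket (left_inv_field X) (left_inv_field Y) (chart_map phi 1%g).

End LieAlgebraOfLieGroup.

Section SubspaceOfSet.
Variables (K : fieldType) (V : vectType K).

(* The subspace with underlying set [P] (0 if [P] is not a subspace). *)
Definition vspace_of (P : set V) : {vspace V} :=
  xget 0%VS [set U : {vspace V} | forall x, x \in U <-> P x].

Lemma vspace_ofP (P : set V) : P 0 ->
  (forall a x y, P x -> P y -> P (a *: x + y)) ->
  forall x, x \in vspace_of P <-> P x.
Proof.
move=> P0 Plin.
suff [U UP] : exists U : {vspace V}, forall x, x \in U <-> P x.
  by rewrite /vspace_of; case: xgetP => [W _ //|/(_ U)[]].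
pose Q d := `[< exists2 U : {vspace V}, \dim U = d & forall x, x \in U -> P x >].
have exQ : exists d, Q d.
  exists 0%N; apply/asboolP; exists 0%VS; first by rewrite dimv0.
  by move=> x; rewrite memv0 => /eqP ->.
have ubQ d : Q d -> (d <= \dim {:V})%N.
  by move=> /asboolP[U <- _]; rewrite dimvS ?subvf.
case: (ex_maxnP exQ ubQ) => d /asboolP[U dU UP] maxd.
exists U => x; split=> [/UP//|Px].
have Usub : (U <= U + <[x]>)%VS := addvSl _ _.
have : Q (\dim (U + <[x]>)).
  apply/asboolP; exists (U + <[x]>)%VS => // y /memv_addP[u /UP Pu [w]].
  by case/vlineP=> a -> ->; rewrite addrC; exact: Plin.
move=> /maxd; rewrite -dU => le_dim.
have /eqP -> : U == (U + <[x]>)%VS.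
  by rewrite -(geq_leqif (dimv_leqif_eq Usub)).
by rewrite (subvP (addvSr _ _)) // memv_line.
Qed.

End SubspaceOfSet.

(* The complexification of g = R^n is C^n, conjugation being entrywise. *)
Section Complexification.
Variables (R : realType) (n : nat).
Local Notation C := R[i].
Local Notation g := 'rV[R]_n.
Local Notation gC := 'rV[C]_n.

Definition re_rv (z : gC) : g := map_mx (@complex.Re R) z.
Definition im_rv (z : gC) : g := map_mx (@complex.Im R) z.
Definition complex_rv (x y : g) : gC := \row_j Complex (x 0 j) (y 0 j).
Definition conj_rv (z : gC) : gC := map_mx (@conjc R) z.

Definition conj_vs (U : {vspace gC}) : {vspace gC} :=
  vspace_of [set z | conj_rv z \in U].

(* t (x) C, as a subspace of g (x) C. *)
Definition complexify (t : {vspace g}) : {vspace gC} :=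
  vspace_of [set z | re_rv z \in t /\ im_rv z \in t].

Lemma mem_conj_vs (U : {vspace gC}) z : (z \in conj_vs U) = (conj_rv z \in U).
Proof.
have H : z \in conj_vs U <-> conj_rv z \in U.
  apply: (@vspace_ofP _ _ [set z | conj_rv z \in U]) => /=.
    by rewrite /conj_rv map_mx0 mem0v.
  move=> a x y Ux Uy.
  have -> : conj_rv (a *: x + y) = conjc a *: conj_rv x + conj_rv y.
    by apply/rowP => j; rewrite !mxE rmorphD rmorphM.
  by rewrite memvD ?memvZ.
by case: H => H1 H2; apply/idP/idP.
Qed.

Lemma mem_complexify (t : {vspace g}) z :
  (z \in complexify t) = (re_rv z \in t) && (im_rv z \in t).
Proof.
have H : z \in complexify t <-> re_rv z \in t /\ im_rv z \in t.
  apply: (@vspace_ofP _ _ [set z | re_rv z \in t /\ im_rv z \in t]) => /=.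
    by rewrite /re_rv /im_rv !map_mx0 mem0v.
  move=> a x y [xr xi] [yr yi].
  have -> : re_rv (a *: x + y) = complex.Re a *: re_rv x
      - complex.Im a *: im_rv x + re_rv y.
    by apply/rowP => j; rewrite !mxE; case: a (x 0 j) (y 0 j) => ? ? [? ?] [].
  have -> : im_rv (a *: x + y) = complex.Re a *: im_rv x
      + complex.Im a *: re_rv x + im_rv y.
    by apply/rowP => j; rewrite !mxE; case: a (x 0 j) (y 0 j) => ? ? [? ?] [].
  by split; rewrite memvD // ?memvB ?memvD ?memvZ.
by case: H => H1 H2; apply/idP/andP.
Qed.

Variable br : g -> g -> g.

Definition brC (z w : gC) : gC :=
  complex_rv (br (re_rv z) (re_rv w) - br (im_rv z) (im_rv w))
             (br (re_rv z) (im_rv w) + br (im_rv z) (re_rv w)).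

Definition abelian_subalgebra (t : {vspace g}) : Prop :=
  forall x y, x \in t -> y \in t -> br x y = 0.

Definition maximal_abelian (t : {vspace g}) : Prop :=
  abelian_subalgebra t /\
  forall s : {vspace g}, abelian_subalgebra s -> (t <= s)%VS -> s = t.

Definition complex_subalgebra (u : {vspace gC}) : Prop :=
  forall z w, z \in u -> w \in u -> brC z w \in u.

(* [v] is an elliptic subalgebra of minimal rank in [u], where the conjugation
   invariant subalgebra [u] has complex dimension 2r + 1. *)
Definition elliptic_min_rank (r : nat) (u v : {vspace gC}) : Prop :=
  [/\ complex_subalgebra v, (v <= u)%VS, (v + conj_vs v)%VS = u
    & \dim v = r.+1].

Section Roots.
Variable t : {vspace g}.

Definition root_form := 'Hom(subvs_of (complexify t), C^o).

Definition root_space (a : root_form) : {vspace gC} :=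
  vspace_of [set z | forall h, brC (vsval h) z = (a h : C) *: z].

Definition is_root (a : root_form) : Prop := a <> 0 /\ root_space a <> 0%VS.

(* The (finite) set of positive roots is listed without repetition. *)
Definition positive_system (D : seq root_form) : Prop :=
  [/\ uniq D,
      forall a, a \in D -> is_root a,
      forall a, is_root a -> (a \in D) = (- a \notin D)
    & forall a b, a \in D -> b \in D -> a <> b -> is_root (a + b) ->
        a + b \in D].

End Roots.

End Complexification.

(* Main.v *)
(* The bounded group Ad G preserves a positive definite form, the minimizer of a
   strictly convex invariant function on a convex set of forms.  Differentiating
   Ad, every ad X with X in g is skew for it; let ( , ) be its Hermitian
   extension to g_C.  Put tau z := tr (pi ad z pi), where pi is
   the orthogonal projection onto v, and let H represent the functional tau:
   (z, H) = tau z.  Then H lies in i g, and for u in v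
     tau [u, ubar] = |pi ad u pi|^2 - |ad ubar pi|^2 = - |(1 - pi) ad ubar pi|^2
   is nonpositive, and vanishes only if ubar normalizes v.  If X = u + ubar
   (u in v) commutes with H, then tau [u, ubar] = ([X, ubar], H) = 0; hence the
   centralizer of H consists of the z such that z and zbar normalize v, and
   it equals e + ebar with e its intersection with v.  Here [e, ebar] lies in the
   intersection line of v and vbar, where it must vanish, and then [e, e] = 0 by
   invariance.
   So t := ker (ad H) is abelian, hence maximal abelian, and it normalizes v: v
   is spanned by weight vectors.  For a weight vector u in v with weight a <> 0
   the sign of tau [u, ubar] gives a(H) > 0, so the positive roots are those with
   a(H) > 0, and their root spaces lie in v because v + vbar = g_C. *)
From HB Require Import structures.
Require Import Defs.
From mathcomp Require Import all_boot all_order all_algebra.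
From mathcomp Require Import all_classical all_reals all_analysis.
From mathcomp Require Import complex zify ring lra.

Set Implicit Arguments.
Unset Strict Implicit.
Unset Printing Implicit Defensive.

Import Order.TTheory GRing.Theory Num.Theory numFieldNormedType.Exports.
Import passmx.

Local Open Scope classical_set_scope.
Local Open Scope ring_scope.

(** * Inner products, brackets and weights *)

(** An arbitrary maximal abelian subalgebra need not be adapted to [v], so t has to be built from
    [v] itself. The Killing form cannot serve, since it degenerates on the centre of g; this is why
    an invariant form is drawn from compactness. For that form the adjoint of ad z is minus ad zbar,
    which gives a sign to a trace on [v], although [v] is not stable under conjugation: the failure
    of ad ubar to preserve [v] is the defect in Bessel's inequality. A posteriori tau restricts to
    t_C as the sum of the positive roots, so H is dual to 2 rho, a regular element; this explains
    why its centralizer is a Cartan subalgebra, though the argument only manipulates signs. The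
    analytic half has an obstacle of its own: smoothness is given by iterated directional
    derivatives in charts, so Frechet differentiability, the symmetry of second derivatives, the
    derivative of Ad and the Jacobi identity are all derived from the multiplication map read in
    charts. *)

Lemma linear_exists (K : pzRingType) (U V : lmodType K) (f : U -> V) :
  linear f -> exists L : {linear U -> V}, L =1 f.
Proof.
move=> flin; pose lM := GRing.isLinear.Build _ _ _ _ _ flin.
by pose L : {linear U -> V} := HB.pack f lM; exists L.
Qed.

Lemma linear_linfun (K : fieldType) (aT rT : vectType K) (f : aT -> rT) :
  linear f -> exists F : 'Hom(aT, rT), F =1 f.
Proof.
by move=> /linear_exists[L LE]; exists (linfun L) => x; rewrite lfunE LE.
Qed.

Section InnerProduct.
Variables (C : numClosedFieldType) (V : vectType C) (hf : V -> V -> C).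
Hypothesis hfl : forall a x y z, hf (a *: x + y) z = a * hf x z + hf y z.
Hypothesis hfC : forall x y, hf y x = (hf x y)^*.
Hypothesis hf_gt0 : forall x, x != 0 -> 0 < hf x x.

Lemma hfDl x y z : hf (x + y) z = hf x z + hf y z.
Proof. by rewrite -[x in LHS]scale1r hfl mul1r. Qed.
Lemma hf0l z : hf 0 z = 0.
Proof. by apply: (addIr (hf 0 z)); rewrite -hfDl !add0r. Qed.
Lemma hfZl a x z : hf (a *: x) z = a * hf x z.
Proof. by rewrite -[a *: x]addr0 hfl hf0l addr0. Qed.
Lemma hfNl x z : hf (- x) z = - hf x z.
Proof. by rewrite -scaleN1r hfZl mulN1r. Qed.
Lemma hfBl x y z : hf (x - y) z = hf x z - hf y z.
Proof. by rewrite hfDl hfNl. Qed.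
Lemma hf_suml I (r : seq I) (P : pred I) (F : I -> V) z :
  hf (\sum_(i <- r | P i) F i) z = \sum_(i <- r | P i) hf (F i) z.
Proof. by elim/big_ind2: _ => [|x1 x2 y1 y2 <- <-|//]; rewrite ?hf0l ?hfDl. Qed.
Lemma hfDr x y z : hf z (x + y) = hf z x + hf z y.
Proof. by rewrite (hfC (x + y)) hfDl rmorphD /= -!hfC. Qed.
Lemma hf0r z : hf z 0 = 0.
Proof. by rewrite hfC hf0l conjC0. Qed.
Lemma hfZr a x z : hf z (a *: x) = a^* * hf z x.
Proof. by rewrite (hfC (a *: x)) hfZl rmorphM /= -hfC. Qed.
Lemma hfNr x z : hf z (- x) = - hf z x.
Proof. by rewrite (hfC (- x)) hfNl rmorphN /= -hfC. Qed.
Lemma hfBr x y z : hf z (x - y) = hf z x - hf z y.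
Proof. by rewrite hfDr hfNr. Qed.
Lemma hf_sumr I (r : seq I) (P : pred I) (F : I -> V) z :
  hf z (\sum_(i <- r | P i) F i) = \sum_(i <- r | P i) hf z (F i).
Proof. by elim/big_ind2: _ => [|x1 x2 y1 y2 <- <-|//]; rewrite ?hf0r ?hfDr. Qed.

Lemma hf_ge0 x : 0 <= hf x x.
Proof. by have [->|/hf_gt0/ltW//] := eqVneq x 0; rewrite hf0l. Qed.
Lemma hf_eq0 x : hf x x = 0 -> x = 0.
Proof. by have [//|/hf_gt0/lt0r_neq0/eqP] := eqVneq x 0. Qed.

Lemma orthov_directP (U W : {vspace V}) :
  (forall x y, x \in U -> y \in W -> hf x y = 0) -> (U :&: W = 0)%VS.
Proof.
move=> orth; apply/eqP; rewrite -subv0; apply/subvP => x /memv_capP[xU xW].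
by rewrite memv0; apply/eqP/hf_eq0/orth.
Qed.

Lemma orthov_span (ws : seq V) z : (forall w, w \in ws -> hf w z = 0) ->
  forall x, x \in <<ws>>%VS -> hf x z = 0.
Proof.
elim: ws => [|w ws IH] wsz x; first by rewrite span_nil memv0 => /eqP->; rewrite hf0l.
rewrite span_cons => /memv_addP[_ /vlineP[k ->] [y yws ->]].
rewrite hfl wsz ?mem_head// mulr0 add0r IH// => u uws.
by rewrite wsz// inE uws orbT.
Qed.

Lemma span_expand (ws : seq V) x : uniq ws ->
  {in ws &, forall u w, hf u w = (u == w)%:R} -> x \in <<ws>>%VS ->
  x = \sum_(u <- ws) hf x u *: u.
Proof.
elim: ws x => [|w ws IH] x; first by rewrite span_nil memv0 big_nil => _ _ /eqP.
move=> /= /andP[wws uws] on; rewrite span_cons => /memv_addP[_ /vlineP[k ->] [y yws ->]].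
have wy u : u \in ws -> hf w u = 0.
  move=> us; rewrite on ?inE ?eqxx ?us ?orbT//; case: eqP => // wu.
  by rewrite wu us in wws.
have yw : hf y w = 0.
  apply: orthov_span yws => u us.
  by rewrite hfC wy// conjC0.
rewrite big_cons hfl yw addr0 on ?mem_head// eqxx mulr1; congr (_ + _).
rewrite {1}(IH y)//; last by move=> a b aws bws; rewrite on// inE ?aws ?bws orbT.
by apply: eq_big_seq => u us; rewrite hfl wy// mulr0 add0r.
Qed.

(** * Simultaneous diagonalization of a commuting family closed under adjoints *)

Section Eigenbasis.
Variable T : 'End(V) -> Prop.
Hypothesis comm : forall f g, T f -> T g -> forall x, f (g x) = g (f x).

Lemma stable_eigenvector (U : {vspace V}) (f : 'End(V)) :
  (forall x, x \in U -> f x \in U) -> U != 0%VS ->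
  exists a w, [/\ w \in U, w != 0 & f w = a *: w].
Proof.
move=> fU U0.
pose f' : 'End(subvs_of U) := linfun (vsproj U \o f \o vsval).
have e_basis := vbasisP (fullv : {vspace subvs_of U}).
have [|a eig] := eigenvalue_closed (mxof (vbasis fullv) (vbasis fullv) f').
  by rewrite dimvf /dim /= lt0n dimv_eq0.
have : leigenspace f' a != 0%VS.
  by rewrite (leigenspaceE e_basis) vsof_eq0.
rewrite -vpick0; set w := vpick _ => w0.
have := memv_pick (leigenspace f' a); rewrite -/w memv_ker => /eqP.
rewrite add_lfunE opp_lfunE scale_lfunE id_lfunE lfunE /= => /eqP.
rewrite subr_eq0 => /eqP /(congr1 vsval); rewrite linearZ/= vsprojK; last exact/fU/subvsP.
move=> fw; exists a, (vsval w); split => //; exact: subvsP.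
Qed.

(** [T] may be infinite, so the induction is on the dimension of [U]: either every member acts on
    [U] as a scalar, or some [f] does not, and then an eigenspace of [f] in [U] is nonzero, proper
    and, by commutation, stable under [T]. *)
Lemma common_eigenvector_in (U : {vspace V}) :
  (forall f x, T f -> x \in U -> f x \in U) -> U != 0%VS ->
  exists w, [/\ w \in U, w != 0 & forall f, T f -> exists a, f w = a *: w].
Proof.
have [d] := ubnP (\dim U); elim: d U => // d IH U; rewrite ltnS => dU TU U0.
have [sc|] := pselect (forall f, T f -> exists a, forall x, x \in U -> f x = a *: x).
  exists (vpick U); split; rewrite ?memv_pick ?vpick0// => f /sc[a fa].
  by exists a; apply/fa/memv_pick.
move=> /existsNP[f /not_implyP[Tf /forallNP nsc]].
have [a [w [wU w0 fw]]] := stable_eigenvector (fun x => TU f x Tf) U0.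
pose W := (U :&: leigenspace f a)%VS.
have WE x : (x \in W) = (x \in U) && (f x == a *: x).
  rewrite memv_cap memv_ker add_lfunE opp_lfunE scale_lfunE id_lfunE.
  by rewrite subr_eq0.
have WU : (W <= U)%VS by apply: capvSl.
have ltW : (\dim W < \dim U)%N.
  rewrite (ltn_leqif (dimv_leqif_sup WU)); apply/negP => /subvP UW.
  by apply: (nsc a) => x /UW; rewrite WE => /andP[_ /eqP].
have [|g x Tg||u [uW u0 uT]] := IH W.
- exact: leq_trans dU.
- rewrite !WE => /andP[xU /eqP fx]; rewrite TU//= comm// fx linearZ//=.
- apply: contra w0 => /eqP W0; rewrite -memv0 -W0 WE wU fw eqxx//.
by exists u; split => //; apply: (subvP WU).
Qed.

Hypothesis adj : forall f, T f ->
  exists2 g, T g & forall x y, hf (f x) y = hf x (g y).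

(** Closure under adjoints makes the orthogonal complement of a common eigenvector stable again, so
    that one can split off one unit vector at a time. *)
Lemma orthonormal_eigenbasis (U : {vspace V}) :
  (forall f x, T f -> x \in U -> f x \in U) ->
  exists ws : seq V, [/\ <<ws>>%VS = U, uniq ws,
    {in ws &, forall u w, hf u w = (u == w)%:R} &
    forall w f, w \in ws -> T f -> exists a, f w = a *: w].
Proof.
have [d] := ubnP (\dim U); elim: d U => // d IH U; rewrite ltnS => dU TU.
have [->|U0] := eqVneq U 0%VS.
  by exists [::]; rewrite span_nil; split.
have [w0 [w0U w0n w0T]] := common_eigenvector_in TU U0.
pose w := (sqrtC (hf w0 w0))^-1 *: w0.
have s0 : sqrtC (hf w0 w0) != 0 by rewrite sqrtC_eq0 gt_eqF// hf_gt0.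
have ww : hf w w = 1.
  rewrite hfZl hfZr geC0_conj ?invr_ge0 ?sqrtC_ge0 ?hf_ge0//.
  by rewrite mulrA -expr2 exprVn sqrtCK mulVf// gt_eqF// hf_gt0.
have wU : w \in U by rewrite memvZ.
have wT f : T f -> exists a, f w = a *: w.
  by move=> /w0T[a fa]; exists a; rewrite linearZ/= fa !scalerA mulrC.
have hlin : linear (fun x => hf x w : C^o) by move=> a x y /=; rewrite hfl.
pose hL := GRing.isLinear.Build _ _ _ _ _ hlin.
pose h : {linear V -> C^o} := HB.pack (fun x => hf x w : C^o) hL.
pose W := (U :&: lker (linfun h))%VS.
have WE x : (x \in W) = (x \in U) && (hf x w == 0).
  by rewrite memv_cap memv_ker lfunE.
have WU : (W <= U)%VS by apply: capvSl.
have ltW : (\dim W < \dim U)%N.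
  rewrite (ltn_leqif (dimv_leqif_sup WU)); apply/negP => /subvP/(_ w wU).
  by rewrite WE ww oner_eq0 andbF.
have [|f x Tf|ws [wsW uws onws wsT]] := IH W; first exact: leq_trans dU.
  rewrite !WE => /andP[xU /eqP xw]; rewrite TU//=.
  by have [g Tg ->] := adj Tf; have [a ->] := wT g Tg; rewrite hfZr xw mulr0.
have wsw u : u \in ws -> hf u w = 0.
  by move=> /memv_span; rewrite wsW WE => /andP[_ /eqP].
exists (w :: ws); split.
- apply/eqP; rewrite span_cons wsW eqEsubv; apply/andP; split.
    by rewrite subv_add WU -memvE wU.
  apply/subvP => x xU; apply/memv_addP; exists (hf x w *: w); first
    by rewrite memvZ ?memv_line.
  exists (x - hf x w *: w); last by rewrite addrC subrK.
  by rewrite WE memvB ?memvZ//= hfBl hfZl ww mulr1 subrr.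
- rewrite /= uws andbT; apply/negP => /wsw; rewrite ww => /eqP.
  by rewrite oner_eq0.
- have nw u : u \in ws -> (u == w) = false.
    by move=> us; apply: contraTF us => /eqP ->; apply/negP => /wsw/eqP;
      rewrite ww oner_eq0.
  move=> u u'; rewrite !inE => /orP[/eqP->|us] /orP[/eqP->|us'].
  + by rewrite ww eqxx.
  + by rewrite hfC wsw// conjC0 eq_sym nw.
  + by rewrite wsw// nw.
  + exact: onws.
- move=> u f; rewrite inE => /orP[/eqP->|us] Tf; [exact: wT|exact: wsT].
Qed.
End Eigenbasis.

(** Diagonalizing the empty family of operators amounts to Gram-Schmidt. *)
Lemma orthonormal_basis (U : {vspace V}) :
  exists ws : seq V, [/\ <<ws>>%VS = U, uniq ws &
    {in ws &, forall u w, hf u w = (u == w)%:R}].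
Proof.
have [//|//|//|ws [? ? ? _]] := @orthonormal_eigenbasis (fun=> False) _ _ U.
by exists ws.
Qed.

(** The remainder [x - y] after projection is orthogonal to [y], so the defect is its squared norm.
    The equality case is what later converts a vanishing trace into the stability of [v]. *)
Lemma bessel (us : seq V) x : uniq us ->
  {in us &, forall u w, hf u w = (u == w)%:R} ->
  \sum_(u <- us) `|hf x u| ^+ 2 <= hf x x
    ?= iff (x \in <<us>>%VS).
Proof.
move=> uus on; pose y := \sum_(u <- us) hf x u *: u.
have yus : y \in <<us>>%VS.
  rewrite /y big_seq; apply: memv_suml => u us_u; rewrite memvZ// memv_span//.
have hy u : u \in us -> hf (x - y) u = 0.
  move=> us_u; rewrite hfBl /y hf_suml (bigD1_seq u)//= hfZl (on u u)// eqxx mulr1.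
  rewrite big_seq_cond big1 ?addr0 ?subrr// => w /andP[ws wu].
  by rewrite hfZl (on w u)// (negPf wu) mulr0.
have hxy : hf (x - y) y = 0.
  by rewrite hfC (orthov_span _ yus) ?conjC0// => u us_u; rewrite hfC hy// conjC0.
have yy : hf y y = \sum_(u <- us) `|hf x u| ^+ 2.
  have -> : hf y y = hf y (\sum_(u <- us) hf x u *: u) by [].
  rewrite hf_sumr; apply: eq_big_seq => u us_u.
  have /eqP := hy u us_u; rewrite hfBl subr_eq0 => /eqP hxu.
  by rewrite hfZr -hxu normCK mulrC.
have xx : hf x x = hf y y + hf (x - y) (x - y).
  have -> : hf x x = hf (x - y + y) (x - y + y) by rewrite subrK.
  move: hxy; set d := x - y => hdy; rewrite hfDl (hfDr d y d) (hfDr d y y) hdy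
    (hfC d y) hdy conjC0.
  by rewrite addr0 add0r addrC.
rewrite -yy; split; rewrite xx ?lerDl ?hf_ge0//.
rewrite -subr_eq0 opprD addNKr oppr_eq0.
apply/eqP/idP => [/hf_eq0/eqP|xus]; first by rewrite subr_eq0 => /eqP ->.
by rewrite [X in X - _](span_expand uus on xus) -/y subrr hf0l.
Qed.

Lemma hf_nondeg x y : (forall z, hf z x = hf z y) -> x = y.
Proof.
by move=> xy; apply/subr0_eq/hf_eq0; rewrite hfBr xy subrr.
Qed.

Lemma riesz (f : {linear V -> C^o}) : exists x, forall y, hf y x = f y.
Proof.
have [ws [wsV uws on]] := orthonormal_basis fullv.
exists (\sum_(w <- ws) (f w)^* *: w) => y.
rewrite [in RHS](span_expand uws on (x := y)) ?wsV ?memvf//.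
rewrite hf_sumr linear_sum; apply: eq_bigr => w _.
by rewrite hfZr conjCK linearZ /= mulrC.
Qed.

(* [hf], [cj] and [bk] stand for the Hermitian extension of an invariant form
   of g, the conjugation and the bracket of the complexification of g. *)
Section Bracket.
Variables (cj : V -> V) (bk : V -> V -> V).
Hypothesis cjK : involutive cj.
Hypothesis cjD : forall x y, cj (x + y) = cj x + cj y.
Hypothesis cjZ : forall a x, cj (a *: x) = a^* *: cj x.
Hypothesis hf_cj : forall x y, hf (cj x) (cj y) = (hf x y)^*.
Hypothesis bkl : forall a x y z, bk (a *: x + y) z = a *: bk x z + bk y z.
Hypothesis bkA : forall x y, bk y x = - bk x y.
Hypothesis bkJ : forall x y z, bk x (bk y z) = bk (bk x y) z + bk y (bk x z).
Hypothesis cj_bk : forall x y, cj (bk x y) = bk (cj x) (cj y).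
Hypothesis hf_inv : forall x y z, hf (bk x y) z = - hf y (bk (cj x) z).

Lemma bkDl x y z : bk (x + y) z = bk x z + bk y z.
Proof. by rewrite -[x in LHS]scale1r bkl scale1r. Qed.
Lemma bk0l z : bk 0 z = 0.
Proof. by apply: (addIr (bk 0 z)); rewrite -bkDl !add0r. Qed.
Lemma bkZl a x z : bk (a *: x) z = a *: bk x z.
Proof. by rewrite -[a *: x]addr0 bkl bk0l addr0. Qed.
Lemma bkNl x z : bk (- x) z = - bk x z.
Proof. by rewrite -scaleN1r bkZl scaleN1r. Qed.
Lemma bkDr x y z : bk z (x + y) = bk z x + bk z y.
Proof. by rewrite bkA bkDl opprD -!bkA. Qed.
Lemma bkZr a x z : bk z (a *: x) = a *: bk z x.
Proof. by rewrite bkA bkZl -scalerN -bkA. Qed.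
Lemma bkNr x z : bk z (- x) = - bk z x.
Proof. by rewrite bkA bkNl -bkA. Qed.
Lemma bk0r z : bk z 0 = 0.
Proof. by rewrite bkA bk0l oppr0. Qed.
Lemma bkxx x : bk x x = 0.
Proof.
have : bk x x *+ 2 = 0 by rewrite mulr2n {1}bkA addNr.
by rewrite -(scaler_nat 2 (bk x x)) => /eqP; rewrite scaler_eq0 pnatr_eq0 => /eqP.
Qed.
Lemma bk_sumr I (r : seq I) (P : pred I) (F : I -> V) z :
  bk z (\sum_(i <- r | P i) F i) = \sum_(i <- r | P i) bk z (F i).
Proof. by elim/big_ind2: _ => [|x1 x2 y1 y2 <- <-|//]; rewrite ?bk0r ?bkDr. Qed.
Lemma cj0 : cj 0 = 0.
Proof. by have := cjZ 0 0; rewrite conjC0 !scale0r. Qed.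
Lemma cjN x : cj (- x) = - cj x.
Proof. by rewrite -scaleN1r cjZ rmorphN1 scaleN1r. Qed.

Variable v : {vspace V}.
Hypothesis v_sub : forall x y, x \in v -> y \in v -> bk x y \in v.
Hypothesis v_full : forall z, exists x y, [/\ x \in v, y \in v & z = x + cj y].
(** Minimal rank in the form used here: the intersection of [v] with its conjugate has dimension at
    most 1. *)
Hypothesis v_line : exists w, forall x, x \in v -> cj x \in v -> exists k, x = k *: w.

Definition normalizes x := forall y, y \in v -> bk x y \in v.

Lemma normalizesD x y : normalizes x -> normalizes y -> normalizes (x + y).
Proof. by move=> nx ny z zv; rewrite bkDl memvD ?nx ?ny. Qed.

(** * The trace functional attached to [v] *)

Section Trace.
Variable us : seq V.
Hypotheses (uus : uniq us) (usv : <<us>>%VS = v).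
Hypothesis onus : {in us &, forall u w, hf u w = (u == w)%:R}.

(* The trace of the compression of [bk z] to [v]. *)
Definition tau z := \sum_(u <- us) hf (bk z u) u.

Let us_v u : u \in us -> u \in v. Proof. by move=> ?; rewrite -usv memv_span. Qed.

Lemma normalizes_us x : (forall u, u \in us -> bk x u \in v) -> normalizes x.
Proof.
move=> xus y; rewrite -{1}usv => /(span_expand uus onus) ->.
rewrite bk_sumr big_seq; apply: memv_suml => u us_u.
by rewrite bkZr memvZ ?xus.
Qed.

(* By invariance the matrix of the compression of [bk (cj x)] is minus the
   adjoint of that of [bk x]; as [bk x] preserves [v], the trace is minus the
   sum of the defects in Bessel's inequality for the vectors [bk (cj x) u]. *)
Lemma tau_bracket_cj x : x \in v -> tau (bk x (cj x)) <= 0 /\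
  (tau (bk x (cj x)) = 0 -> normalizes (cj x)).
Proof.
move=> xv.
have tauE : tau (bk x (cj x)) = - \sum_(u <- us)
    (hf (bk (cj x) u) (bk (cj x) u) - \sum_(w <- us) `|hf (bk (cj x) u) w| ^+ 2).
  have -> : tau (bk x (cj x)) = \sum_(u <- us)
      (hf (bk x u) (bk x u) - hf (bk (cj x) u) (bk (cj x) u)).
    apply: eq_bigr => u _.
    have /eqP := bkJ x (cj x) u; rewrite -subr_eq => /eqP <-.
    by rewrite hfBl (hf_inv x (bk (cj x) u)) (hf_inv (cj x) (bk x u)) cjK opprK addrC.
  (* The norms of the [bk x u] become sums of squared matrix entries, because [bk x] preserves [v];
     after exchanging the two sums, invariance identifies them with the entries of [bk (cj x)]. *)
  rewrite !sumrB opprB; congr (_ - _).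
  rewrite exchange_big /=; apply: eq_big_seq => u us_u.
  have xu : bk x u \in <<us>>%VS by rewrite usv v_sub// us_v.
  have [_] := bessel (bk x u) uus onus; rewrite xu => /eqP <-.
  apply: eq_bigr => w _.
  by rewrite hf_inv hfC normrN norm_conjC.
have ge0 u : 0 <= hf (bk (cj x) u) (bk (cj x) u) - \sum_(w <- us) `|hf (bk
  (cj x) u) w| ^+ 2.
  by rewrite subr_ge0; have [] := bessel (bk (cj x) u) uus onus.
split; rewrite tauE; first by rewrite oppr_le0 sumr_ge0.
move/eqP; rewrite oppr_eq0 psumr_eq0// => /allP all0.
apply: normalizes_us => u /all0 /=; rewrite subr_eq0 eq_sym.
by have [_ ->] := bessel (bk (cj x) u) uus onus; rewrite usv.
Qed.

(** When both [bk x] and its adjoint [- bk (cj x)] preserve [v], compression to [v] takes the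
    commutator of [bk x] with [bk y] to the commutator of the compressions, whose trace is 0. *)
Lemma tau_normalizes x : normalizes x -> normalizes (cj x) ->
  forall y, tau (bk x y) = 0.
Proof.
move=> nx ncx y.
have -> : tau (bk x y) = \sum_(u <- us) (- hf (bk y u) (bk (cj x) u))
    - \sum_(u <- us) hf (bk y (bk x u)) u.
  rewrite -sumrB; apply: eq_bigr => u _.
  by have /eqP := bkJ x y u; rewrite -subr_eq => /eqP <-; rewrite hfBl hf_inv.
apply/eqP; rewrite subr_eq0; apply/eqP.
transitivity (\sum_(u <- us) \sum_(w <- us) hf (bk x w) u * hf (bk y u) w).
  apply: eq_big_seq => u us_u.
  have cxu : bk (cj x) u \in <<us>>%VS by rewrite usv ncx// us_v.
  rewrite [X in hf _ X](span_expand uus onus cxu) hf_sumr -sumrN.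
  by apply: eq_bigr => w _; rewrite hfZr hf_inv cjK rmorphN /= -hfC mulNr opprK.
rewrite exchange_big /=; apply: eq_big_seq => u us_u.
have xu : bk x u \in <<us>>%VS by rewrite usv nx// us_v.
rewrite [X in bk y X](span_expand uus onus xu) bk_sumr hf_suml.
by apply: eq_bigr => w _; rewrite bkZr hfZl.
Qed.

Lemma tau_cj y : tau (cj y) = - (tau y)^*.
Proof.
rewrite /tau raddf_sum /= -sumrN; apply: eq_bigr => u _.
by rewrite hf_inv cjK hfC.
Qed.
End Trace.

(** Riesz representation of [tau]. From here on the orthonormal basis of [v] is forgotten and only
    these four properties of [H] remain; the first says that [H] is purely imaginary. *)
Lemma trace_vector : exists H, [/\ cj H = - H,
  (forall x, x \in v -> hf (bk x (cj x)) H <= 0),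
  (forall x, x \in v -> hf (bk x (cj x)) H = 0 -> normalizes (cj x)) &
  (forall x, normalizes x -> normalizes (cj x) -> forall y, hf (bk x y) H = 0)].
Proof.
have [us [usv uus onus]] := orthonormal_basis v.
have tlin : linear (tau us : V -> C^o).
  move=> a x y; rewrite /tau scaler_sumr -big_split /=; apply: eq_bigr => u _.
  by rewrite bkl hfl.
pose tL := GRing.isLinear.Build _ _ _ _ _ tlin.
pose t : {linear V -> C^o} := HB.pack (tau us : V -> C^o) tL.
have [H HE] := riesz t; exists H; split.
- apply: hf_nondeg => z; rewrite -{1}[z]cjK hf_cj HE /= tau_cj ?hfNr ?HE //=.
  by change ((- (tau us z)^*)^* = - tau us z :> C); rewrite rmorphN /= conjCK.
- by move=> x xv; rewrite HE; have [] := tau_bracket_cj uus usv onus xv.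
- by move=> x xv; rewrite HE; have [] := tau_bracket_cj uus usv onus xv.
- by move=> x nx ncx y; rewrite HE; exact: tau_normalizes.
Qed.

(** * The centralizer of the trace vector is abelian and normalizes [v] *)

Section Centralizer.
Variable H : V.
Hypothesis cjH : cj H = - H.
Hypothesis H_le0 : forall x, x \in v -> hf (bk x (cj x)) H <= 0.
Hypothesis H_eq0 : forall x, x \in v -> hf (bk x (cj x)) H = 0 -> normalizes (cj x).
Hypothesis H_comm : forall x, normalizes x -> normalizes (cj x) ->
  forall y, hf (bk x y) H = 0.
(** [A] is left abstract in order to be instantiated with [complexify t]; the linear forms on [A]
    are then literally the [root_form]s of [t]. *)
Variable A : {vspace V}.
Hypothesis AE : forall z, (z \in A) = (bk z H == 0).

Lemma mem_cj_A z : z \in A -> cj z \in A.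
Proof.
rewrite !AE => /eqP zH; rewrite -[H]opprK -cjH bkNr -cj_bk zH cj0 oppr0.
by rewrite eqxx.
Qed.

(** By invariance (y, [z, H]) = - ([cj z, y], H) for every y, and the right-hand side is 0 by
    [H_comm] applied to [cj z]. *)
Lemma normalizes_A z : normalizes z -> normalizes (cj z) -> z \in A.
Proof.
move=> nz ncz; rewrite AE; apply/eqP/hf_nondeg => y.
apply/eqP; rewrite hf0r -oppr_eq0 -[z]cjK -hf_inv; apply/eqP.
by apply: H_comm => //; rewrite cjK.
Qed.

Lemma real_split x : cj x = x -> exists2 y, y \in v & x = y + cj y.
Proof.
move=> xr; have [y [z [yv zv xyz]]] := v_full x.
(* A real [x = y + cj z] also equals [z + cj y]; the witness averages the two. *)
exists (2^-1 *: (y + z)); first by rewrite memvZ ?memvD.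
have h2 : (2^-1)^* = 2^-1 :> C by rewrite geC0_conj ?invr_ge0.
rewrite cjZ h2 -scalerDr cjD [cj y + _]addrC addrACA [z + _]addrC -xyz.
rewrite [cj y + z](_ : _ = x); last by rewrite -[RHS]xr xyz cjD cjK.
by rewrite -mulr2n -(scaler_nat 2 x) scalerA mulVf ?scale1r// pnatr_eq0.
Qed.

Lemma real_split_normalizes x : cj x = x -> x \in A ->
  exists y, [/\ y \in v, normalizes (cj y) & x = y + cj y].
Proof.
move=> xr xA; have [y yv xy] := real_split xr; exists y; split => //.
apply: H_eq0 => //; rewrite -[bk y _]addr0 -[0 in X in hf X _](bkxx (cj y)) -bkDl -xy.
by move: xA; rewrite AE hf_inv xr => /eqP ->; rewrite hf0r oppr0.
Qed.

Lemma A_split z : z \in A -> exists x y,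
  [/\ x \in v, y \in v, normalizes (cj x), normalizes (cj y) & z = x + cj y].
Proof.
move=> zA; have czA := mem_cj_A zA.
have h2 : (2^-1)^* = 2^-1 :> C by rewrite geC0_conj ?invr_ge0.
have i2 : 'i * 'i = -1 :> C by rewrite -expr2 sqrCi.
have [||a [av na aE]] := @real_split_normalizes (2^-1 *: (z + cj z)).
- by rewrite cjZ h2 cjD cjK addrC.
- by rewrite memvZ ?memvD.
have [||c [cv nc cE]] := @real_split_normalizes (2^-1 *: ('i *: (cj z - z))).
- by rewrite !cjZ h2 cjD cjN cjK conjCi scaleNr -scalerN opprB.
- by rewrite memvZ// memvZ// memvB.
(* The real part of [z] is [a + cj a] and its imaginary part is [c + cj c]. Since ['i *: cj c] is
   the conjugate of [- ('i *: c)], the second witness carries a minus sign. *)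
exists (a + 'i *: c), (a - 'i *: c); split.
- by rewrite memvD ?memvZ.
- by rewrite memvB ?memvZ.
- rewrite cjD cjZ; apply: normalizesD => // y yv.
  by rewrite bkZl memvZ// nc.
- rewrite cjD cjN cjZ; apply: normalizesD => // y yv.
  by rewrite bkNl memvN bkZl memvZ// nc.
rewrite cjD cjN cjZ conjCi scaleNr opprK addrACA -aE -scalerDr -cE.
rewrite !scalerA (mulrC 'i) -mulrA i2 mulrN1 scaleNr -scalerN -scalerDr opprB.
by rewrite addrACA subrr addr0 -mulr2n -(scaler_nat 2 z) scalerA mulVf ?scale1r
  ?pnatr_eq0.
Qed.

Lemma A_normalizes z : z \in A -> normalizes z.
Proof.
move=> /A_split[x [y [xv yv _ ny ->]]]; apply: normalizesD => // w wv.
exact: v_sub.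
Qed.

(** If nonzero, the bracket w spans the line common to [v] and its conjugate, which is stable under
    ad x and ad (cj x). Conjugation shows that their eigenvalues on w are conjugate, and invariance
    then forces l = - l, so both vanish. Finally (w, w) = - (cj y, [cj x, w]) = 0. *)
Lemma bracket_cj_eq0 x y : x \in v -> y \in v -> normalizes (cj x) ->
  normalizes (cj y) -> bk x (cj y) = 0.
Proof.
move=> xv yv nx ny; apply/eqP/negPn/negP => w0.
set w := bk x (cj y) in w0.
have wv : w \in v by rewrite /w bkA memvN ny.
have cwv : cj w \in v by rewrite /w cj_bk cjK nx.
have [w1 line] := v_line.
have lin z : z \in v -> cj z \in v -> exists k, z = k *: w.
  move=> zv czv; have [k wk] := line w wv cwv; have [l zl] := line z zv czv.
  have k0 : k != 0 by apply: contra w0 => /eqP k0; rewrite wk k0 scale0r.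
  by exists (l / k); rewrite wk scalerA divfK.
have [m cwm] := lin (cj w) cwv (eq_ind_r (fun z => z \in v) wv (cjK w)).
have [|l xl] := lin (bk (cj x) w) (nx w wv).
  by rewrite cj_bk cjK v_sub.
have m0 : m != 0.
  apply: contra w0 => /eqP m0; rewrite -[w]cjK cwm m0 scale0r cj0 //.
have xw : bk x w = l^* *: w.
  have := congr1 cj xl; rewrite cj_bk cjK cjZ cwm bkZr scalerA mulrC -scalerA.
  by apply: (can_inj (scalerK m0)).
have hww : hf w w != 0 by rewrite gt_eqF ?hf_gt0.
have l0 : l = 0.
  have := hf_inv (cj x) w w; rewrite cjK xw xl hfZl hfZr conjCK => /eqP.
  by rewrite -addr_eq0 -mulr2n mulrn_eq0 /= mulf_eq0 (negPf hww) orbF => /eqP.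
move/eqP: hww; apply; rewrite {1}/w hf_inv xl l0 scale0r hf0r oppr0 //.
Qed.

(** With w = [x, y] one has (w, w) = - (y, [cj x, w]). The bracket on the right is 0 by
    [bracket_cj_eq0] for w and x, as w is again in [v] and [cj w] normalizes [v]. *)
Lemma bracket_eq0 x y : x \in v -> y \in v -> normalizes (cj x) ->
  normalizes (cj y) -> bk x y = 0.
Proof.
move=> xv yv nx ny; apply: hf_eq0; rewrite {1}hf_inv.
have nxy : normalizes (cj (bk x y)).
  move=> z zv; rewrite cj_bk.
  have /eqP := bkJ (cj x) (cj y) z; rewrite -subr_eq => /eqP <-.
  by rewrite memvB ?(nx, ny).
by rewrite bkA bracket_cj_eq0 ?oppr0 ?hf0r ?oppr0 ?v_sub.
Qed.

Lemma A_abelian z w : z \in A -> w \in A -> bk z w = 0.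
Proof.
move=> /A_split[x [y [xv yv nx ny ->]]] /A_split[x' [y' [xv' yv' nx' ny' ->]]].
rewrite bkDl !bkDr bracket_eq0 // bracket_cj_eq0// -cj_bk (bracket_eq0 yv)//.
by rewrite bkA bracket_cj_eq0// cj0 oppr0 !addr0.
Qed.

(** * Weights of the centralizer and the positive system *)

Section Weights.
Local Notation form := 'Hom(subvs_of A, C^o).
Variable W : form -> {vspace V}.
Hypothesis WE : forall a z,
  z \in W a <-> forall h, bk (vsval h) z = (a h : C) *: z.
Implicit Types (a b : form).

Let Hs : subvs_of A := vsproj A H.

Lemma val_Hs : vsval Hs = H.
Proof. by rewrite vsprojK// AE bkxx. Qed.

Lemma formP a b : (forall h, a h = b h) -> a = b.
Proof. by move=> ab; apply/lfunP. Qed.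

Lemma weight_mem_A a z : z \in W a -> a Hs = 0 -> z \in A.
Proof.
move=> /WE/(_ Hs); rewrite val_Hs => Hz aH.
by rewrite AE bkA Hz aH scale0r oppr0.
Qed.

Lemma mem_A_weight0 z : z \in A -> z \in W 0.
Proof.
by move=> zA; apply/WE => h; rewrite lfunE /= scale0r A_abelian// subvsP.
Qed.

Lemma weight_A_eq0 a z : z \in W a -> z \in A -> z != 0 -> a = 0.
Proof.
move=> /WE za zA z0; apply: formP => h; rewrite [RHS]lfunE /=; apply/eqP.
have /esym/eqP := za h; rewrite A_abelian ?subvsP// scaler_eq0.
by rewrite (negPf z0) orbF.
Qed.

(** The adjoint of [bk h] is [- bk (cj h)]; on the real points of [A] this says that weights take
    imaginary values. *)
Lemma weight_conj a z (h : subvs_of A) : z \in W a -> z != 0 ->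
  (a (vsproj A (cj (vsval h))) : C)^* = - (a h : C).
Proof.
move=> /WE za z0; have hz0 : hf z z != 0 by rewrite gt_eqF ?hf_gt0.
apply: (mulIf hz0).
rewrite mulNr -[a h * _]hfZl -hfZr -!za hf_inv vsprojK ?opprK//.
by rewrite mem_cj_A// subvsP.
Qed.

Lemma mem_weight_cj a z : z \in W a -> cj z \in W (- a).
Proof.
have [->|z0] := eqVneq z 0; first by rewrite cj0 !mem0v.
move=> zW; apply/WE => h; rewrite opp_lfunE /= -(weight_conj h zW z0).
rewrite -cjZ; move/WE: zW => <-; rewrite cj_bk vsprojK ?cjK//.
by rewrite mem_cj_A// subvsP.
Qed.

Lemma weight_orth a b x y : x \in W a -> y \in W b -> a != b -> hf x y = 0.
Proof.
have [-> _ _ _|y0] := eqVneq y 0; first by rewrite hf0r.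
move=> xW yW; apply: contra_neq_eq => xy0; apply: formP => h.
apply: (mulIf xy0); rewrite -[LHS]hfZl; move/WE: (xW) => <-; rewrite hf_inv.
rewrite -[vsval h in LHS]cjK cjK.
have -> : cj (vsval h) = vsval (vsproj A (cj (vsval h))).
  by rewrite vsprojK// mem_cj_A// subvsP.
by move/WE: (yW) => ->; rewrite hfZr (weight_conj h yW y0) mulNr opprK.
Qed.

(** Invariance and [cj H = - H] give a(H) (z, z) = ([H, z], z) = - ([z, cj z], H), which is
    nonnegative by [H_le0]. It is not 0, for otherwise [z] would centralize [H] and have weight
    0. *)
Lemma weight_v_gt0 a z : z \in v -> z \in W a -> z != 0 -> a != 0 ->
  0 < (a Hs : C).
Proof.
move=> zv zW z0 a0; have hz0 := hf_gt0 z0.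
have aH0 : a Hs != 0.
  by apply: contra a0 => /eqP /(weight_mem_A zW) zA; apply/eqP/(weight_A_eq0 zW).
rewrite lt_def aH0 /= -(pmulr_lge0 _ hz0) -hfZl.
have -> : (a Hs : C) *: z = bk H z by move/WE: zW => <-; rewrite val_Hs.
rewrite hf_inv cjH bkNl hfNr opprK -oppr_le0.
have := H_le0 zv.
rewrite bkA hfNl hf_inv cjK opprK [bk z H]bkA hfNr.
by rewrite [bk H z](_ : _ = (a Hs : C) *: z); last by move/WE: zW => <-; rewrite val_Hs.
Qed.

Lemma weight_list : exists ws : seq V, [/\ <<ws>>%VS = v,
  (forall w, w \in ws -> w != 0) & forall w, w \in ws -> exists a, w \in W a].
Proof.
pose T (f : 'End(V)) := exists2 h, h \in A & f =1 bk h.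
have ad_T h : h \in A -> exists2 f, T f & f =1 bk h.
  move=> hA; have [|f fE] := @linear_linfun _ _ _ (bk h).
    by move=> a x y /=; rewrite bkDr bkZr.
  by exists f => //; exists h.
have [|||ws [wsv uws on wsT]] := @orthonormal_eigenbasis T _ _ v.
- move=> f g' [h hA fE] [h' hA' gE] x; rewrite !fE !gE.
  by rewrite bkJ (A_abelian hA hA') bk0l add0r.
- move=> f [h hA fE]; have [|g' Tg gE] := ad_T (- cj h); first by rewrite memvN mem_cj_A.
  by exists g' => // x y; rewrite fE gE hf_inv bkNl hfNr.
- by move=> f x [h hA fE] xv; rewrite fE A_normalizes.
have hww w : w \in ws -> hf w w = 1 by move=> wws; rewrite on// eqxx.
exists ws; split=> // w wws.
  by apply: contra_eq_neq (hww w wws) => ->; rewrite hf0l eq_sym oner_eq0.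
(* The eigenvalue is read off as ([h, w], w) with [w] of norm 1, so its linearity in [h] comes for
   free. *)
have [|a aE] := @linear_linfun _ (subvs_of A) C^o (fun h => hf (bk (vsval h) w) w).
  by move=> c x y; rewrite linearP bkl hfl.
exists a; apply/WE => h; rewrite aE.
have [f Tf fE] := ad_T _ (subvsP h).
by have [c] := wsT w f wws Tf; rewrite fE => ->; rewrite hfZl hww// mulr1.
Qed.

(** Split [z] into the part [x] with weight [a] and the rest [y]. Then [y = z - x] has weight [a]
    too, yet lies in the span of vectors of other weights, so it is orthogonal to itself. *)
Lemma weight_filter (zs : seq V) (f : V -> form) a z :
  (forall x, x \in zs -> x \in W (f x)) -> z \in <<zs>>%VS -> z \in W a ->
  z \in <<[seq x <- zs | f x == a]>>%VS.
Proof.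
move=> zsW; have : perm_eq ([seq x <- zs | f x == a] ++ [seq x <- zs | f x != a]) zs.
  exact: permEl (perm_filterC _ _).
move=> /perm_mem/eq_span <-; rewrite span_cat => /memv_addP[x xs [y ys zxy]] zW.
have xW : x \in W a.
  move: xs; apply: subvP; apply/span_subvP => u;
    rewrite mem_filter => /andP[/eqP <- /zsW//].
have y0 : hf y y = 0.
  apply: orthov_span ys => u; rewrite mem_filter => /andP[ua /zsW uW].
  apply: weight_orth uW _ ua.
  by rewrite (_ : y = z - x) ?memvB// zxy addrC addKr.
by rewrite zxy (hf_eq0 y0) addr0.
Qed.

Lemma positive_weights : exists D : seq form,
  [/\ uniq D,
      forall a, a \in D -> a <> 0 /\ W a <> 0%VS,
      forall a, a <> 0 /\ W a <> 0%VS -> (a \in D) = (- a \notin D),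
      forall a b, a \in D -> b \in D -> a <> b -> a + b <> 0 /\ W (a + b) <> 0%VS ->
        a + b \in D &
      v = ((v :&: A) + \sum_(a <- D) W a)%VS].
Proof.
have [ws [wsv ws0 wsW]] := weight_list.
have wsv' w : w \in ws -> w \in v by move=> ?; rewrite -wsv memv_span.
have [f0 f0E] : exists f : V -> form, forall w, w \in ws -> w \in W (f w).
  have : forall w, exists a, w \in ws -> w \in W a.
    move=> w; case: (boolP (w \in ws)) => [/wsW[a wa]|_]; first by exists a.
    by exists 0.
  by move=> /boolp.choice[f1 f1P]; exists f1.
pose D := undup [seq a <- map f0 ws | a != 0].
have DP a : a \in D -> exists w, [/\ w \in ws, w \in W a & a != 0].
  rewrite mem_undup mem_filter => /andP[a0 /mapP[w wws aw]].
  by exists w; split=> //; rewrite aw; exact: f0E.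
have D_gt0 a : a \in D -> 0 < (a Hs : C).
  move=> /DP[w [wws wa a0]].
  by apply: (weight_v_gt0 (wsv' w wws) wa) => //; exact: ws0.
have f0D w : w \in ws -> f0 w != 0 -> f0 w \in D.
  by move=> wws f0w; rewrite mem_undup mem_filter f0w map_f.
(* Weight vectors spanning all of [V], with weights in [D], in its opposite, or 0: every root must
   be the weight of one of them. *)
pose zs := ws ++ map cj ws.
have zsV z : z \in <<zs>>%VS.
  have [x [y [xv yv ->]]] := v_full z; rewrite span_cat memv_add ?wsv//.
  move: yv; rewrite -wsv; elim: (ws) y => [|u us IH] y.
    by rewrite span_nil memv0 => /eqP ->; rewrite cj0 mem0v.
  rewrite /= !span_cons => /memv_addP[_ /vlineP[k ->] [y' y's ->]].
  by rewrite cjD cjZ memv_add// ?memvZ ?memv_line ?IH.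
have fuse (a b : form) x : x != 0 -> x \in W a -> x \in W b -> a = b.
  move=> x0 xa xb; apply/eqP/negPn/negP => ab.
  by move/eqP: x0; apply; apply/hf_eq0/(weight_orth xa xb ab).
have [f fE] : exists f : V -> form, forall w, w \in zs -> w \in W (f w).
  have : forall w, exists a, w \in zs -> w \in W a.
    move=> w; rewrite mem_cat; case: (boolP (w \in ws)) => [/wsW[a wa]|_];
      first by exists a.
    case: (boolP (w \in _)) => [/mapP[u us ->]|_]; last by exists 0.
    by exists (- f0 u) => _; rewrite mem_weight_cj ?f0E.
  by move=> /boolp.choice[f1 f1P]; exists f1.
have cj_neq0 w : w != 0 -> cj w != 0.
  by move=> w0; rewrite -(can_eq cjK) cjK cj0.
(* The first alternative records [w \in ws]: for a weight in [D], [DN] excludes the second one, so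
   that the weight vector lies in [v]. This yields the inclusion of the positive root spaces in [v]
   at the end. *)
have fD w : w \in zs -> f w != 0 -> (w \in ws) && (f w \in D) || (- f w \in D).
  move=> wzs fw0; have := fE w wzs; move: wzs; rewrite mem_cat => /orP[wws fw|].
    by have fw' := fuse _ _ _ (ws0 w wws) fw (f0E w wws); rewrite wws {1}fw' f0D// -fw'.
  move=> /mapP[u us wu]; rewrite {1}wu => fw.
  have fu := fuse _ _ _ (cj_neq0 u (ws0 u us)) fw (mem_weight_cj (f0E u us)).
  by rewrite fu opprK f0D ?orbT// -oppr_eq0 -fu.
have DN a : a \in D -> - a \in D -> False.
  move=> /D_gt0 aH /D_gt0; rewrite opp_lfunE /= oppr_gt0 => /(lt_trans aH).
  by rewrite ltxx.
have rootD a : a <> 0 /\ W a <> 0%VS -> (a \in D) || (- a \in D).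
  move=> [/eqP a0 /eqP]; rewrite -vpick0 => z0.
  have := weight_filter fE (zsV (vpick (W a))) (memv_pick (W a)).
  have [->|] := eqVneq [seq x <- zs | f x == a] [::].
    by rewrite span_nil memv0 (negPf z0).
  rewrite -size_eq0 -lt0n -has_predT => /hasP[w];
    rewrite mem_filter => /andP[/eqP wa wzs] _ _.
  by have := fD w wzs; rewrite wa => /(_ a0) /orP[/andP[_ ->]|->]; rewrite ?orbT.
exists D; split.
- exact: undup_uniq.
- move=> a /DP[w [wws wa a0]]; split; first exact/eqP.
  by move=> W0; move: wa; rewrite W0 memv0 (negPf (ws0 w wws)).
- move=> a /rootD; case: (boolP (a \in D)) => [aD _|_ /= ->//].
  by apply/esym/negP => /(DN a aD).
(* Otherwise the opposite of [a + b] would lie in [D], against the positivity of both [a] and [b] on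
   [H]. *)
- move=> a b aD bD _ /rootD /orP[//|/D_gt0].
  rewrite opp_lfunE /= add_lfunE oppr_gt0 => h.
  have := addr_gt0 (D_gt0 a aD) (D_gt0 b bD).
  by move=> /lt_trans/(_ h); rewrite ltxx.
apply/eqP; rewrite eqEsubv; apply/andP; split.
  rewrite -{1}wsv; apply/span_subvP => w wws.
  have [fw0|fw0] := eqVneq (f0 w) 0.
    rewrite memvE (subv_trans _ (addvSl _ _))// -memvE memv_cap wsv'//=.
    by apply: (weight_mem_A (f0E w wws)); rewrite fw0 lfunE.
  rewrite memvE (subv_trans _ (addvSr _ _))// -memvE.
  rewrite (big_rem (f0 w)) ?f0D//=; apply: (subvP (addvSl _ _)); exact: f0E.
rewrite subv_add capvSl /= big_seq.
elim/big_ind: _ => [|U1 U2 U1v U2v|a aD]; [exact: sub0v|by rewrite subv_add U1v|].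
apply/subvP => z za.
have := weight_filter fE (zsV z) za; apply: subvP; apply/span_subvP => w.
rewrite mem_filter => /andP[/eqP wa wzs].
have a0 : a != 0 by have [w' []] := DP a aD.
have := fD w wzs; rewrite wa => /(_ a0)/orP[/andP[/wsv' //]|].
by move=> /(DN a aD).
Qed.

(** Distinct weight spaces are orthogonal, and [U] sits in the weight space of 0 because [A] is
    abelian; directness is then a count of dimensions. *)
Lemma weight_direct (U : {vspace V}) (D : seq form) : uniq D -> (U <= A)%VS ->
  0 \notin D -> directv (U + \sum_(a <- D) W a).
Proof.
move=> uD UA D0; rewrite directvE /=.
have orth x (E : seq form) y b : x \in W b -> b \notin E ->
    y \in (\sum_(a <- E) W a)%VS -> hf x y = 0.
  move=> xb; elim: E y => [|a E IH] y.
    by rewrite big_nil memv0 => _ /eqP ->; rewrite hf0r.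
  rewrite inE big_cons negb_or => /andP[ba bE] /memv_addP[y1 y1a [y2 y2E ->]].
  by rewrite hfDr (weight_orth xb y1a ba) IH ?addr0.
have dimE : (\dim (\sum_(a <- D) W a) = \sum_(a <- D) \dim (W a))%N.
  elim: D uD {D0} => [|a D IH] /=; first by rewrite !big_nil dimv0.
  move=> /andP[aD uD]; rewrite !big_cons -IH// dimv_disjoint_sum//.
  by apply: orthov_directP => x y xa yD; exact: (orth x D y a).
rewrite dimv_disjoint_sum ?dimE//.
apply: orthov_directP => x y /(subvP UA)/mem_A_weight0 x0 yD.
exact: (orth x D y 0).
Qed.
End Weights.

End Centralizer.
End Bracket.
End InnerProduct.

(** * The complexified Lie algebra *)

Section ComplexRow.
Variables (R : realType) (n : nat).
Local Notation C := R[i].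
Local Notation g := 'rV[R]_n.
Local Notation gC := 'rV[C]_n.
Implicit Types (x y : g) (z w : gC).

Lemma complex_rv_inj z w : re_rv z = re_rv w -> im_rv z = im_rv w -> z = w.
Proof.
move=> /rowP rzw /rowP izw; apply/rowP => j; apply/eqP; rewrite eq_complex.
by move: (rzw j) (izw j); rewrite !mxE => -> ->; rewrite !eqxx.
Qed.
Lemma re_complex x y : re_rv (complex_rv x y) = x.
Proof. by apply/rowP => j; rewrite !mxE. Qed.
Lemma im_complex x y : im_rv (complex_rv x y) = y.
Proof. by apply/rowP => j; rewrite !mxE. Qed.
Lemma re_rvD z w : re_rv (z + w) = re_rv z + re_rv w.
Proof. by apply/rowP => j; rewrite !mxE raddfD. Qed.
Lemma im_rvD z w : im_rv (z + w) = im_rv z + im_rv w.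
Proof. by apply/rowP => j; rewrite !mxE raddfD. Qed.
Lemma re_rvN z : re_rv (- z) = - re_rv z.
Proof. by apply/rowP => j; rewrite !mxE raddfN. Qed.
Lemma im_rvN z : im_rv (- z) = - im_rv z.
Proof. by apply/rowP => j; rewrite !mxE raddfN. Qed.
Lemma re_rvZ a z : re_rv (a *: z) = complex.Re a *: re_rv z - complex.Im a *: im_rv z.
Proof. by apply/rowP => j; rewrite !mxE; case: a (z 0 j) => ? ? []. Qed.
Lemma im_rvZ a z : im_rv (a *: z) = complex.Re a *: im_rv z + complex.Im a *: re_rv z.
Proof. by apply/rowP => j; rewrite !mxE; case: a (z 0 j) => ? ? []. Qed.
Lemma re_conj z : re_rv (conj_rv z) = re_rv z.
Proof. by apply/rowP => j; rewrite !mxE; case: (z 0 j). Qed.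
Lemma im_conj z : im_rv (conj_rv z) = - im_rv z.
Proof. by apply/rowP => j; rewrite !mxE; case: (z 0 j). Qed.
Lemma re_rv0 : re_rv (0 : gC) = 0.
Proof. by apply/rowP => j; rewrite !mxE. Qed.
Lemma im_rv0 : im_rv (0 : gC) = 0.
Proof. by apply/rowP => j; rewrite !mxE. Qed.
Definition rvE := (re_complex, im_complex, re_rvD, im_rvD, re_rvN, im_rvN,
  re_rvZ, im_rvZ, re_conj, im_conj, re_rv0, im_rv0).

Lemma conj_rvK : involutive (@conj_rv R n).
Proof. by move=> z; apply: complex_rv_inj; rewrite !rvE ?opprK. Qed.
Lemma conj_rvD z w : conj_rv (z + w) = conj_rv z + conj_rv w.
Proof. by apply: complex_rv_inj; rewrite !rvE ?opprD. Qed.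
Lemma conj_rv0 : conj_rv (0 : gC) = 0.
Proof. by apply: complex_rv_inj; rewrite !rvE ?oppr0. Qed.
Lemma conj_rvZ a z : conj_rv (a *: z) = (a^*)%C *: conj_rv z.
Proof. by apply/rowP => j; rewrite !mxE rmorphM. Qed.

Lemma conj_vs_span (ws : seq gC) :
  conj_vs <<ws>> = <<map (@conj_rv R n) ws>>%VS.
Proof.
have sub (us : seq gC) (x : gC) : x \in <<us>>%VS -> conj_rv x \in <<map
  (@conj_rv R n) us>>%VS.
  elim: us x => [|u us IH] x; first by rewrite span_nil !memv0 => /eqP ->;
    rewrite conj_rv0.
  rewrite /= !span_cons => /memv_addP[_ /vlineP[k ->] [y yus ->]].
  by rewrite conj_rvD conj_rvZ memv_add// ?memvZ ?memv_line// IH.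
apply/vspaceP => z; rewrite mem_conj_vs; apply/idP/idP => /sub; rewrite ?conj_rvK//.
by rewrite mapK//; exact: conj_rvK.
Qed.

(** Conjugation is only semilinear. Conjugating a basis gives one inequality, and the involution
    gives the other. *)
Lemma dim_conj_vs (U : {vspace gC}) : \dim (conj_vs U) = \dim U.
Proof.
have le (W : {vspace gC}) : (\dim (conj_vs W) <= \dim W)%N.
  have -> : conj_vs W = <<map (@conj_rv R n) (vbasis W)>>%VS.
    by rewrite -conj_vs_span (span_basis (vbasisP W)).
  by apply: leq_trans (dim_span _) _; rewrite size_map size_tuple.
apply/eqP; rewrite eqn_leq le /=.
suff {1}-> : U = conj_vs (conj_vs U) by [].
by apply/vspaceP => z; rewrite !mem_conj_vs conj_rvK.
Qed.

Lemma re_rv_sum I (r : seq I) P (F : I -> gC) :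
  re_rv (\sum_(i <- r | P i) F i) = \sum_(i <- r | P i) re_rv (F i).
Proof. by elim/big_ind2: _ => [|a b c d <- <-|//]; rewrite ?re_rv0 ?re_rvD. Qed.
Lemma im_rv_sum I (r : seq I) P (F : I -> gC) :
  im_rv (\sum_(i <- r | P i) F i) = \sum_(i <- r | P i) im_rv (F i).
Proof. by elim/big_ind2: _ => [|a b c d <- <-|//]; rewrite ?im_rv0 ?im_rvD. Qed.

Lemma dim_complexify (t : {vspace g}) : \dim (complexify t) = \dim t.
Proof.
pose f (x : g) : gC := complex_rv x 0.
pose B := map_tuple f (vbasis t).
have BE i : B`_i = f (vbasis t)`_i.
  have [ilt|ige] := ltnP i (size (vbasis t)); first by rewrite (nth_map 0).
  rewrite !nth_default ?size_map//.
  by apply: complex_rv_inj; rewrite !rvE.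
have reB (k : 'I_(\dim t) -> C) :
    re_rv (\sum_i k i *: B`_i) = \sum_i complex.Re (k i) *: (vbasis t)`_i.
  rewrite re_rv_sum; apply: eq_bigr => i _.
  by rewrite BE !rvE scaler0 subr0.
have imB (k : 'I_(\dim t) -> C) :
    im_rv (\sum_i k i *: B`_i) = \sum_i complex.Im (k i) *: (vbasis t)`_i.
  rewrite im_rv_sum; apply: eq_bigr => i _.
  by rewrite BE !rvE scaler0 add0r.
have /freeP freeb := basis_free (vbasisP t).
suff Bb : basis_of (complexify t) B by rewrite (size_basis Bb).
rewrite basisEfree size_tuple; apply/and3P; split.
- apply/freeP => k k0 i; apply/eqP; rewrite eq_complex /=; apply/andP; split; apply/eqP.
    by apply: (freeb (fun i => complex.Re (k i))); rewrite -reB k0 re_rv0.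
  by apply: (freeb (fun i => complex.Im (k i))); rewrite -imB k0 im_rv0.
- apply/span_subvP => _ /mapP[x /vbasis_mem xt ->].
  by rewrite mem_complexify !rvE mem0v xt.
have sub : (complexify t <= <<B>>)%VS.
  apply/subvP => z; rewrite mem_complexify => /andP[rt it].
  have -> : z = \sum_i (Complex (coord (vbasis t) i (re_rv z))
                         (coord (vbasis t) i (im_rv z)) : C) *: B`_i.
    by apply: complex_rv_inj; rewrite ?reB ?imB /= -coord_vbasis.
  by apply: memv_suml => i _; rewrite memvZ// memv_span// mem_nth// size_tuple.
by have := leq_trans (dimvS sub) (dim_span B); rewrite size_tuple.
Qed.
End ComplexRow.

(** * Bracket and Hermitian form on the complexification *)

Section ComplexLie.
Variables (R : realType) (n : nat).
Local Notation C := R[i].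
Local Notation g := 'rV[R]_n.
Local Notation gC := 'rV[C]_n.
Variables (br : g -> g -> g) (b : g -> g -> R).
Hypothesis br_lin : forall a x y z, br (a *: x + y) z = a *: br x z + br y z.
Hypothesis brA : forall x y, br y x = - br x y.
Hypothesis brJ : forall x y z, br x (br y z) = br (br x y) z + br y (br x z).
Hypothesis b_lin : forall a x y z, b (a *: x + y) z = a * b x z + b y z.
Hypothesis bC : forall x y, b y x = b x y.
Hypothesis b_gt0 : forall x, x != 0 -> 0 < b x x.
Hypothesis b_inv : forall x y z, b (br x y) z = - b y (br x z).

Lemma brDl x y z : br (x + y) z = br x z + br y z.
Proof. by rewrite -[x in LHS]scale1r br_lin scale1r. Qed.
Lemma br0l z : br 0 z = 0.
Proof. by apply: (addIr (br 0 z)); rewrite -brDl !add0r. Qed.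
Lemma brZl a x z : br (a *: x) z = a *: br x z.
Proof. by rewrite -[a *: x]addr0 br_lin br0l addr0. Qed.
Lemma brNl x z : br (- x) z = - br x z.
Proof. by rewrite -scaleN1r brZl scaleN1r. Qed.
Lemma brDr x y z : br z (x + y) = br z x + br z y.
Proof. by rewrite brA brDl opprD -!brA. Qed.
Lemma brZr a x z : br z (a *: x) = a *: br z x.
Proof. by rewrite brA brZl -scalerN -brA. Qed.
Lemma brNr x z : br z (- x) = - br z x.
Proof. by rewrite brA brNl -brA. Qed.
Lemma br0r z : br z 0 = 0.
Proof. by rewrite brA br0l oppr0. Qed.
Definition brE := (brDl, brZl, brNl, br0l, brDr, brZr, brNr, br0r).

Lemma bDl x y z : b (x + y) z = b x z + b y z.
Proof. by rewrite -[x in LHS]scale1r b_lin mul1r. Qed.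
Lemma b0l z : b 0 z = 0.
Proof. by apply: (addIr (b 0 z)); rewrite -bDl !add0r. Qed.
Lemma bZl a x z : b (a *: x) z = a * b x z.
Proof. by rewrite -[a *: x]addr0 b_lin b0l addr0. Qed.
Lemma bNl x z : b (- x) z = - b x z.
Proof. by rewrite -scaleN1r bZl mulN1r. Qed.
Lemma bDr x y z : b z (x + y) = b z x + b z y.
Proof. by rewrite bC bDl !(bC z). Qed.
Lemma bZr a x z : b z (a *: x) = a * b z x.
Proof. by rewrite bC bZl !(bC z). Qed.
Lemma bNr x z : b z (- x) = - b z x.
Proof. by rewrite bC bNl !(bC z). Qed.
Definition bE := (bDl, bZl, bNl, bDr, bZr, bNr).

Local Notation brC := (brC br).

Lemma brC_lin a x y z : brC (a *: x + y) z = a *: brC x z + brC y z.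
Proof.
by apply: complex_rv_inj; rewrite !rvE !brE; apply/rowP => j; rewrite !mxE; ring.
Qed.
Lemma brCA x y : brC y x = - brC x y.
Proof.
apply: complex_rv_inj; rewrite !rvE.
  rewrite (brA (re_rv x) (re_rv y)) (brA (im_rv x) (im_rv y)).
  by apply/rowP => j; rewrite !mxE; ring.
rewrite (brA (im_rv x) (re_rv y)) (brA (re_rv x) (im_rv y)).
by apply/rowP => j; rewrite !mxE; ring.
Qed.
Lemma brCJ x y z : brC x (brC y z) = brC (brC x y) z + brC y (brC x z).
Proof.
apply: complex_rv_inj; rewrite !rvE !brE.
  rewrite (brJ (re_rv x) (re_rv y)) (brJ (re_rv x) (im_rv y)).
  rewrite (brJ (im_rv x) (re_rv y)) (brJ (im_rv x) (im_rv y)).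
  by apply/rowP => j; rewrite !mxE; ring.
rewrite (brJ (re_rv x) (re_rv y)) (brJ (re_rv x) (im_rv y)).
rewrite (brJ (im_rv x) (re_rv y)) (brJ (im_rv x) (im_rv y)).
by apply/rowP => j; rewrite !mxE; ring.
Qed.
Lemma conj_brC x y : conj_rv (brC x y) = brC (conj_rv x) (conj_rv y).
Proof.
by apply: complex_rv_inj; rewrite !rvE !brE ?opprK ?opprD.
Qed.

Definition hform (z w : gC) : C :=
  Complex (b (re_rv z) (re_rv w) + b (im_rv z) (im_rv w))
          (b (im_rv z) (re_rv w) - b (re_rv z) (im_rv w)).

Lemma hform_lin a x y z : hform (a *: x + y) z = a * hform x z + hform y z.
Proof.
rewrite /hform !rvE !bE; case: a => a1 a2 /=.
by apply/eqP; rewrite eq_complex /=; apply/andP; split; apply/eqP; ring.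
Qed.
Lemma hformC x y : hform y x = (hform x y)^*.
Proof.
apply/eqP; rewrite eq_complex /= (bC (re_rv y)) (bC (im_rv y)) (bC (re_rv y) (im_rv x))
  (bC (im_rv y)); apply/andP; split => //.
by rewrite opprB.
Qed.
Lemma hform_gt0 x : x != 0 -> 0 < hform x x.
Proof.
move=> x0; rewrite ltcE /= (bC (re_rv x)) subrr eqxx /=.
have b_ge0 y : 0 <= b y y by have [->|/b_gt0/ltW//] := eqVneq y 0; rewrite b0l.
have [r0|r0] := eqVneq (re_rv x) 0; last by rewrite ltr_pwDl ?b_gt0.
rewrite ltr_wpDl// b_gt0//; apply: contra x0 => /eqP i0.
by apply/eqP/complex_rv_inj; rewrite rvE.
Qed.
Lemma hform_inv x y z : hform (brC x y) z = - hform y (brC (conj_rv x) z).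
Proof.
rewrite /hform !rvE !brE !bE !b_inv.
by apply/eqP; rewrite eq_complex /=; apply/andP; split; apply/eqP; ring.
Qed.
Lemma hform_conj x y : hform (conj_rv x) (conj_rv y) = (hform x y)^*.
Proof.
rewrite /hform !rvE !bE.
by apply/eqP; rewrite eq_complex /=; apply/andP; split; apply/eqP; ring.
Qed.
End ComplexLie.

(** The purely algebraic half: of the compact group only a Lie bracket with an invariant inner
    product is left. *)
Theorem elliptic_of_invariant_form (R : realType) (k : nat)
    (br : 'rV[R]_(k.*2.+1) -> 'rV[R]_(k.*2.+1) -> 'rV[R]_(k.*2.+1))
    (b : 'rV[R]_(k.*2.+1) -> 'rV[R]_(k.*2.+1) -> R)
    (v : {vspace 'rV[R[i]]_(k.*2.+1)}) :
  (forall a x y z, br (a *: x + y) z = a *: br x z + br y z) ->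
  (forall x y, br y x = - br x y) ->
  (forall x y z, br x (br y z) = br (br x y) z + br y (br x z)) ->
  (forall a x y z, b (a *: x + y) z = a * b x z + b y z) ->
  (forall x y, b y x = b x y) ->
  (forall x, x != 0 -> 0 < b x x) ->
  (forall x y z, b (br x y) z = - b y (br x z)) ->
  elliptic_min_rank br k fullv v ->
  exists t : {vspace 'rV[R]_(k.*2.+1)},
    maximal_abelian br t /\
    exists D : seq (root_form t),
      positive_system br D /\
      let e := (v :&: complexify t)%VS in
      [/\ v = (e + \sum_(a <- D) root_space br a)%VS,
          directv (e + \sum_(a <- D) root_space br a)
        & exists r : nat, \dim t = r.*2.+1 /\
            elliptic_min_rank br r (complexify t) e].
Proof.
move=> br_lin brA brJ b_lin bC b_gt0 b_inv [v_sub _ v_span dv].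
have hfl := hform_lin b_lin; have hfC := hformC bC.
have hf0 := hform_gt0 b_lin bC b_gt0.
have hf_cj := hform_conj b_lin bC.
have hf_inv := hform_inv br_lin b_lin bC b_inv.
have bkl := brC_lin br_lin; have bkA := brCA brA.
have bkJ := brCJ br_lin brA brJ; have cj_bk := conj_brC br_lin brA.
have cjK := @conj_rvK R k.*2.+1; have cjD := @conj_rvD R k.*2.+1.
have cjZ := @conj_rvZ R k.*2.+1.
have v_full z : exists x y, [/\ x \in v, y \in v & z = x + conj_rv y].
  have : z \in (v + conj_vs v)%VS by rewrite v_span memvf.
  move=> /memv_addP[x xv [y yv ->]]; exists x, (conj_rv y); rewrite cjK.
  by split=> //; rewrite -mem_conj_vs.
have dcap : \dim (v :&: conj_vs v) = 1%N.
  have := dimv_sum_cap v (conj_vs v).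
  by rewrite v_span dim_conj_vs dv dimvf /dim /= => h; lia.
have v_line : exists w, forall x, x \in v -> conj_rv x \in v -> exists c, x = c *: w.
  exists (vpick (v :&: conj_vs v)%VS) => x xv cxv; apply/vlineP.
  have w0 : vpick (v :&: conj_vs v) != 0 by rewrite vpick0 -dimv_eq0 dcap.
  have := dimv_leqif_eq (_ : <[vpick (v :&: conj_vs v)]> <= v :&: conj_vs v)%VS.
  rewrite -memvE memv_pick => /(_ isT)[_]; rewrite dcap dim_vline w0 eqxx.
  by move=> /esym/eqP ->; rewrite memv_cap xv mem_conj_vs.
have [H [cjH H_le0 H_eq0 H_comm]] := trace_vector hfl hfC hf0 cjK hf_cj bkl bkA
  bkJ hf_inv v_sub.
have reH : re_rv H = 0.
  have := congr1 (@re_rv R _) cjH; rewrite re_conj re_rvN => /eqP.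
  by rewrite -addr_eq0 -mulr2n -scaler_nat scaler_eq0 pnatr_eq0 => /eqP.
(* [H] is i times [im_rv H], so the real centralizer of [im_rv H] has the centralizer of [H] as its
   complexification. *)
have [ad adE] : exists f : 'Hom('rV[R]_(k.*2.+1), 'rV[R]_(k.*2.+1)), f =1 br^~ (im_rv H).
  by apply: linear_linfun => a x y; rewrite br_lin.
pose t := lker ad.
have tE x : (x \in t) = (br x (im_rv H) == 0) by rewrite memv_ker adE.
have AE z : (z \in complexify t) = (brC br z H == 0).
  rewrite mem_complexify !tE; apply/andP/eqP => [[/eqP r0 /eqP i0]|z0].
    by apply: complex_rv_inj; rewrite !rvE reH !(br0r br_lin brA) ?r0 ?i0 ?subr0 ?addr0.
  have := congr1 (@re_rv R _) z0; have := congr1 (@im_rv R _) z0.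
  rewrite !rvE reH !(br0r br_lin brA) sub0r addr0 => -> /eqP.
  by rewrite oppr_eq0 eqxx => ->.
have abel := A_abelian hfl hfC hf0 cjK cjD cjZ bkl bkA bkJ cj_bk hf_inv v_sub
  v_full v_line cjH H_eq0 AE.
have memt x : (complex_rv x 0 \in complexify t) = (x \in t).
  by rewrite mem_complexify !rvE mem0v andbT.
exists t; split.
  split=> [x y|s sab ts].
    rewrite -!memt => xA /(abel _ _ xA)/(congr1 (@re_rv R _)).
    by rewrite !rvE (br0r br_lin brA) subr0.
  (* [im_rv H] commutes with itself, hence lies in [t] and in [s]; so every element of the abelian
     [s] commutes with it. *)
  apply/eqP; rewrite eqEsubv ts andbT; apply/subvP => x xs; rewrite tE.
  apply/eqP/sab => //; apply: (subvP ts); rewrite tE.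
  have := brA (im_rv H) (im_rv H) => /eqP.
  by rewrite -addr_eq0 -mulr2n -scaler_nat scaler_eq0 pnatr_eq0.
have WE (a : root_form t) z : z \in root_space br a <->
    forall h, brC br (vsval h) z = (a h : R[i]) *: z.
  apply: vspace_ofP => [h /=|c x y xa ya h /=].
    by rewrite scaler0 bkA (bk0l bkl) oppr0.
  by rewrite (bkDr bkl bkA) (bkZr bkl bkA) xa ya scalerDr !scalerA mulrC.
have [D [uD Droot Dpos Dadd vE]] := positive_weights hfl hfC hf0 cjK cjD cjZ bkl
  bkA bkJ cj_bk hf_inv v_sub v_full v_line cjH H_le0 H_eq0 AE WE.
have D0 : 0 \notin D by apply/negP => /Droot[].
exists D; split; first by [].
move=> e; split; first exact: vE.
  apply: (weight_direct hfl hfC hf0 cjK cjD cjZ bkl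
   bkA bkJ cj_bk hf_inv v_sub v_full v_line cjH H_eq0 AE WE) => //; exact: capvSr.
have eA : (e <= complexify t)%VS by apply: capvSr.
have eE : (e + conj_vs e)%VS = complexify t.
  apply/eqP; rewrite eqEsubv subv_add eA /=; apply/andP; split.
    apply/subvP => z; rewrite mem_conj_vs memv_cap => /andP[_ zA].
    by rewrite -[z]cjK; exact: (mem_cj_A cjZ bkl bkA cj_bk cjH AE).
  apply/subvP => z zA.
  have [x [y [xv yv nx ny ->]]] := A_split hfl hfC cjK cjD cjZ bkl bkA cj_bk
    hf_inv v_full cjH H_eq0 AE zA.
  have mem_e w : w \in v -> normalizes (brC br) v (conj_rv w) -> w \in e.
    move=> wv nw; rewrite memv_cap wv.
    by apply: (normalizes_A hfl hfC hf0 cjK hf_inv H_comm AE) => // u uv; exact: v_sub.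
  by rewrite memv_add ?mem_conj_vs ?cjK ?mem_e.
(* An element of [v] whose conjugate is in [v] normalizes [v] together with its conjugate, hence
   lies in [complexify t]: the common line of [v] and its conjugate is already that of [e]. *)
have ecap : \dim (e :&: conj_vs e) = 1%N.
  apply: etrans dcap; congr (\dim _); apply/vspaceP => z.
  rewrite !memv_cap !mem_conj_vs memv_cap.
  have [zv|] := boolP (z \in v); have [czv|] := boolP (conj_rv z \in v);
    rewrite ?andbF//=.
  have zA : z \in complexify t.
    by apply: (normalizes_A hfl hfC hf0 cjK hf_inv H_comm AE) => // u uv; exact: v_sub.
  by rewrite zA (mem_cj_A cjZ bkl bkA cj_bk cjH AE zA).
have := dimv_sum_cap e (conj_vs e); rewrite eE dim_conj_vs ecap dim_complexify => de.
(* The dimension formula reads dim t + 1 = 2 dim e, which gives at once the oddness of dim t and the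
   minimal rank of [e]. *)
exists (\dim e).-1; split; first by lia.
split => //; last by lia.
by move=> x y /(subvP eA) xA /(subvP eA) yA; rewrite abel ?mem0v.
Qed.

(** * Bounded matrix groups preserve a positive definite form *)

Section RowVectors.
Variable R : realType.

Lemma coord_le_norm m n (A : 'M[R]_(m, n)) i j : `|A i j| <= `|A|.
Proof.
rewrite [leRHS]/Num.Def.normr/= mx_normrE.
exact: (le_bigmax _ (fun ij : 'I_m * 'I_n => `|A ij.1 ij.2|) (i, j)).
Qed.

Lemma mx_norm_le m n (A : 'M[R]_(m, n)) c : 0 <= c ->
  (forall i j, `|A i j| <= c) -> `|A| <= c.
Proof.
by move=> c0 Ac; rewrite /Num.Def.normr/= mx_normrE
  (bigmax_le _ c0)// => -[i j] _; exact: Ac.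
Qed.

(** The norm is the largest absolute value of an entry; the factor counts the terms of each entry of
    the product. *)
Lemma mx_normM m n p (A : 'M[R]_(m, n)) (B : 'M[R]_(n, p)) :
  `|A *m B| <= n%:R * `|A| * `|B|.
Proof.
apply: mx_norm_le => [|i j]; first by rewrite !mulr_ge0.
rewrite mxE (le_trans (ler_norm_sum _ _ _))//.
have -> : n%:R * `|A| * `|B| = \sum_(l < n) `|A| * `|B|.
  by rewrite sumr_const card_ord -mulrA mulr_natl.
by apply: ler_sum => l _; rewrite normrM ler_pM//; exact: coord_le_norm.
Qed.

Lemma linear_rV_continuous m (V : normedModType R) (f : {linear 'rV[R]_m -> V}) :
  continuous f.
Proof.
have -> : (f : _ -> V) = \sum_j (fun u : 'rV[R]_m => u 0 j *: f (delta_mx 0 j)).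
  apply/funext => u; rewrite {1}[u]row_sum_delta linear_sum fct_sumE.
  by apply: eq_bigr => j _; rewrite linearZ.
elim/big_ind: _ => [|f1 f2 c1 c2|j _]; first by move=> x; exact: cst_continuous.
  by move=> x; apply: continuousD; [exact: c1|exact: c2].
by move=> x; exact: (cvgZ (@coord_continuous R 1 m 0 j x) (@cvg_cst _ (f
  (delta_mx 0 j)) _ _ _)).
Qed.

Lemma closed_le_continuous (T : topologicalType) (f g : T -> R) :
  continuous f -> continuous g -> closed [set x | f x <= g x].
Proof.
move=> cf cg; have -> : [set x | f x <= g x] = (g \- f) @^-1` [set r | 0 <= r].
  by apply/seteqP; split=> x /=; rewrite subr_ge0.
apply: closed_comp; last exact: closed_ge.
by move=> x _; apply: continuousB; [exact: cg|exact: cf].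
Qed.

Lemma continuous_sumr (T : topologicalType) (V : normedModType R) I (r : seq I)
    (F : I -> T -> V) : (forall i, continuous (F i)) ->
  continuous (fun x => \sum_(i <- r) F i x).
Proof.
move=> cF; elim: r => [|i r IH] x.
  by under eq_fun do rewrite big_nil; exact: cvg_cst.
by under eq_fun do rewrite big_cons; apply: cvgD; [exact: cF|exact: IH].
Qed.

Lemma closed_forall (T : topologicalType) I (P : I -> set T) :
  (forall i, closed (P i)) -> closed [set x | forall i, P i x].
Proof.
move=> cP; have -> : [set x | forall i, P i x] = \bigcap_i P i.
  by apply/seteqP; split=> x Px i; [move=> _|]; exact: Px.
exact: closed_bigI.
Qed.

Lemma ler_1D_of_sqr (x r : R) : 0 <= r -> x ^+ 2 <= r -> x <= 1 + r.
Proof. by move=> r0 xr; nra. Qed.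

Lemma tr_mul_rV n (x : 'rV[R]_n) : (x *m x^T) 0 0 = \sum_j x 0 j ^+ 2.
Proof. by rewrite mxE; apply: eq_bigr => j _; rewrite mxE. Qed.

Lemma sqr_norm_le_rV n (x : 'rV[R]_n) : `|x| ^+ 2 <= (x *m x^T) 0 0.
Proof.
have s0 : 0 <= \sum_j x 0 j ^+ 2 by apply: sumr_ge0 => j _; exact: sqr_ge0.
rewrite tr_mul_rV -(sqr_sqrtr s0) ler_sqr ?nnegrE ?sqrtr_ge0//.
apply: mx_norm_le => [|i j]; first exact: sqrtr_ge0.
rewrite -ler_sqr ?nnegrE ?sqrtr_ge0// sqr_sqrtr// real_normK ?num_real// (ord1 i).
by rewrite (bigD1 j)//= lerDl; apply: sumr_ge0 => l _; exact: sqr_ge0.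
Qed.
End RowVectors.

(** * Minimization over positive definite forms *)

Section InvariantForm.
Variables (R : realType) (n : nat) (S : set 'M[R]_n) (M : R).
Hypothesis S1 : S 1%:M.
Hypothesis SM : forall A B, S A -> S B -> S (A *m B).
Hypothesis SV : forall A, S A -> exists2 B, S B & A *m B = 1%:M.
Hypothesis S_le : forall A, S A -> `|A| <= M.

Let act (A B : 'M[R]_n) := A *m B *m A^T.
Let Q (B : 'M[R]_n) := \sum_i \sum_j B i j ^+ 2.

Let actM A A' B : act (A *m A') B = act A (act A' B).
Proof. by rewrite /act trmx_mul !mulmxA. Qed.

Let Q_ge0 B : 0 <= Q B.
Proof. by do 2![apply: sumr_ge0 => ? _]; exact: sqr_ge0. Qed.

Let Q_ge B : `|B| ^+ 2 <= Q B.
Proof.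
rewrite -(sqr_sqrtr (Q_ge0 B)) ler_sqr ?nnegrE ?sqrtr_ge0//.
apply: mx_norm_le => [|i j]; first exact: sqrtr_ge0.
rewrite -ler_sqr ?nnegrE ?sqrtr_ge0// sqr_sqrtr// real_normK ?num_real//.
rewrite /Q (bigD1 i)//= (bigD1 j)//= -addrA lerDl.
by rewrite addr_ge0//; do ?[apply: sumr_ge0 => ? _]; rewrite ?sqr_ge0.
Qed.

Let Q_le B : Q B <= n%:R * n%:R * `|B| ^+ 2.
Proof.
have -> : n%:R * n%:R * `|B| ^+ 2 = \sum_(i < n) \sum_(j < n) `|B| ^+ 2.
  by rewrite !sumr_const card_ord -mulrA !mulr_natl.
apply: ler_sum => i _; apply: ler_sum => j _.
by rewrite -[leLHS]real_normK ?num_real// ler_sqr ?nnegrE// coord_le_norm.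
Qed.

Let M_ge0 : 0 <= M. Proof. exact: le_trans (S_le S1). Qed.

Let norm_tr m p (A : 'M[R]_(m, p)) : `|A^T| <= `|A|.
Proof. by apply: mx_norm_le => // i j; rewrite mxE coord_le_norm. Qed.

Let c1 := n%:R * M.
Let c1_ge0 : 0 <= c1. Proof. by rewrite mulr_ge0. Qed.

Let norm_act A B : S A -> `|act A B| <= c1 ^+ 2 * `|B|.
Proof.
move=> SA; rewrite /act (le_trans (mx_normM _ _))//.
have h1 : `|A *m B| <= c1 * `|B|.
  by rewrite (le_trans (mx_normM _ _))// ler_wpM2r// ler_wpM2l// S_le.
have h2 : `|A^T| <= M := le_trans (norm_tr A) (S_le SA).
rewrite -mulrA (le_trans (ler_wpM2l _ (ler_pM _ _ h1 h2)))//.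
by rewrite /c1 expr2 le_eqVlt; apply/orP; left; apply/eqP; ring.
Qed.

(** Inverting a member of [S] gives [|x| <= c1 * |x *m A|], so this constant puts the identity
    matrix in [K]. The summand 1 ensures positivity even if [c1] is 0. *)
Let c := (1 + c1) ^- 2.
Let c_gt0 : 0 < c. Proof. by rewrite invr_gt0 exprn_gt0// ltr_wpDr. Qed.

Let q (B : 'M[R]_n) (x : 'rV[R]_n) := (x *m B *m x^T) 0 0.

Let q_act A B x : q (act A B) x = q B (x *m A).
Proof. by rewrite /q /act trmx_mul !mulmxA. Qed.

(** The lower bound is uniform along the orbit of [B]. It is a closed condition, inherited by
    midpoints and by the action, so a minimizer over [K] cannot degenerate. *)
Let K (B : 'M[R]_n) :=
  B^T = B /\ forall A x, S A -> c * `|x| ^+ 2 <= q (act A B) x.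

Let K1 : K 1%:M.
Proof.
split=> [|A x SA]; first exact: trmx1.
rewrite q_act /q mulmx1; apply: le_trans (sqr_norm_le_rV _).
have [B SB AB] := SV SA.
have : `|x| <= (1 + c1) * `|x *m A|.
  rewrite -{1}[x]mulmx1 -AB mulmxA (le_trans (mx_normM _ _))//.
  rewrite -mulrA mulrC -mulrA mulrC ler_wpM2r//.
  rewrite mulrC (le_trans (ler_wpM2l _ (S_le SB)))// /c1 lerDr//.
move=> h; rewrite /c mulrC ler_pdivrMr ?exprn_gt0 ?ltr_wpDr//.
by rewrite mulrC -exprMn ler_sqr ?nnegrE ?mulr_ge0// addr_ge0.
Qed.

Let K_act A B : S A -> K B -> K (act A B).
Proof.
move=> SA [symB KB]; split=> [|A' x SA'].
  by rewrite /act !trmx_mul trmxK symB mulmxA.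
by rewrite -actM; apply/KB/SM.
Qed.

Let K_mid B B' : K B -> K B' -> K (2^-1 *: (B + B')).
Proof.
move=> [symB KB] [symB' KB']; split=> [|A x SA].
  by rewrite linearZ linearD /= symB symB'.
have -> : q (act A (2^-1 *: (B + B'))) x = 2^-1 * (q (act A B) x + q (act A B') x).
  rewrite /q /act -scalemxAr -scalemxAl -scalemxAr -scalemxAl mxE; congr (_ * _).
  by rewrite mulmxDr mulmxDl mulmxDr mulmxDl mxE.
have := KB A x SA; have := KB' A x SA; lra.
Qed.

(** The parallelogram identity of the Frobenius inner product. *)
Let Q_mid A B B' : Q (act A (2^-1 *: (B + B'))) =
  2^-1 * Q (act A B) + 2^-1 * Q (act A B') - 4^-1 * Q (act A (B - B')).
Proof.
have -> : act A (2^-1 *: (B + B')) = 2^-1 *: (act A B + act A B').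
  by rewrite /act -scalemxAr -scalemxAl mulmxDr mulmxDl.
have -> : act A (B - B') = act A B - act A B'.
  by rewrite /act mulmxBr mulmxBl.
rewrite /Q !mulr_sumr -sumrN -!big_split; apply: eq_bigr => i _ /=.
rewrite !mulr_sumr -sumrN -!big_split; apply: eq_bigr => j _ /=.
by rewrite !mxE; field.
Qed.

(* On the convex set [K], the supremum over [A] in [S] of the squared Frobenius
   norms [Q (act A B)] is invariant under [S] and strictly convex by
   [Q_mid], so that its minimizer is a fixed point of [S]. *)
Lemma invariant_form_exists : exists B : 'M[R]_n,
  [/\ B^T = B, forall x : 'rV_n, x != 0 -> 0 < (x *m B *m x^T) 0 0
    & forall A, S A -> A *m B *m A^T = B].
Proof.
(* A pair [(B, r)] with [Q (act A B) <= r] for all [A] in [S] is coded as a row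
   vector, since compactness is available for row vectors. *)
pose N := (n * n + 1)%N.
pose E (u : 'rV[R]_N) : 'M[R]_n := vec_mx (lsubmx u).
pose rho (u : 'rV[R]_N) : R := rsubmx u 0 0.
pose mk (B : 'M[R]_n) (r : R) : 'rV[R]_N := row_mx (mxvec B) (r%:M).
have Emk B r : E (mk B r) = B by rewrite /E /mk row_mxKl mxvecK.
have rhomk B r : rho (mk B r) = r by rewrite /rho /mk row_mxKr mxE.
have E_ij i j : continuous (fun u => E u i j).
  have -> : (fun u => E u i j) = fun u => u 0 (lshift 1 (mxvec_index i j)).
    by apply/funext => u; rewrite !mxE.
  exact: coord_continuous.
have PET_ij m p (P : 'M[R]_(m, n)) (T : 'M[R]_(n, p)) i j :
    continuous (fun u => (P *m E u *m T) i j).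
  have -> : (fun u => (P *m E u *m T) i j) = fun u => \sum_l (P *m E u) i l * T l j.
    by apply/funext => u; rewrite mxE.
  apply: (@continuous_sumr R _ R^o) => l u.
  apply: (@continuousM _ _ (fun u => (P *m E u) i l) (cst (T l j)));
    last exact: cst_continuous.
  have -> : (fun u => (P *m E u) i l) = fun u => \sum_l' P i l' * E u l' l.
    by apply/funext => w; rewrite mxE.
  move: u; apply: (@continuous_sumr R _ R^o) => l' u'.
  by apply: (@continuousM _ _ (cst (P i l')) (fun u => E u l' l));
    [exact: cst_continuous|exact: E_ij].
have rho_c : continuous rho.
  have -> : rho = fun u => u 0 (rshift (n * n) 0).
    by apply/funext => u; rewrite /rho mxE.
  exact: coord_continuous.
have act_c A : continuous (fun u => Q (act A (E u))).
  apply: continuous_sumr => i; apply: (@continuous_sumr R _ R^o) => j u.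
  have cA : continuous (fun u => act A (E u) i j) by exact: PET_ij.
  exact: (@continuousM _ _ _ _ u (cA u) (cA u)).
(* Bounds [Q] on the orbit of the identity. Capping [rho] at [r0] thus leaves [X] nonempty and makes
   it bounded, and pairs above the cap cannot beat the minimum. *)
pose r0 := n%:R * n%:R * (c1 ^+ 2 * `|1%:M : 'M[R]_n|) ^+ 2.
have r0_ge0 : 0 <= r0 by rewrite !mulr_ge0// sqr_ge0.
pose X := [set u | [/\ K (E u), forall A, S A -> Q (act A (E u)) <= rho u & rho u <= r0]].
have [u0 u0X u0min] : exists2 u0, u0 \in X & forall u, u \in X -> rho u0 <= rho u.
  apply: EVT_min_rV.
  - exists (mk 1%:M r0); split; rewrite ?Emk ?rhomk//.
    move=> A SA; rewrite (le_trans (Q_le _))// /r0 ler_wpM2l ?mulr_ge0//.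
    by rewrite ler_sqr ?nnegrE ?mulr_ge0// ?sqr_ge0// norm_act.
  - apply: bounded_closed_compact.
    + exists (1 + r0); split; first exact: num_real.
      move=> r rlt u [Ku Qu ur]; apply: le_trans (ltW rlt).
      have act1 : act 1%:M (E u) = E u by rewrite /act trmx1 mulmx1 mul1mx.
      have QE : Q (E u) <= rho u by rewrite -act1; exact: Qu.
      have Eu : `|E u| <= 1 + r0.
        by apply: ler_1D_of_sqr => //; exact: le_trans (Q_ge _) (le_trans QE ur).
      apply: mx_norm_le => [|i j]; first by rewrite addr_ge0.
      rewrite (ord1 i) -[u]hsubmxK; case: (split_ordP j) => j' ->.
        rewrite row_mxEl; case/mxvec_indexP: j' => i1 j1.
        have -> : lsubmx u 0 (mxvec_index i1 j1) = E u i1 j1 by rewrite [RHS]mxE.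
        exact: le_trans (coord_le_norm _ _ _) Eu.
      rewrite row_mxEr (ord1 j') -/(rho u) ger0_norm; last exact: le_trans QE.
      by rewrite (le_trans ur)// lerDr.
    + have -> : X = [set u | forall ij : 'I_n * 'I_n, E u ij.1 ij.2 <= E u ij.2 ij.1] `&`
          [set u | forall A, S A -> forall x, c * `|x| ^+ 2 <= q (act A (E u)) x] `&`
          [set u | forall A, S A -> Q (act A (E u)) <= rho u] `&` [set u | rho u <= r0].
        apply/seteqP; split=> u /=.
          move=> [[sE KE] QE ur]; split; [split; [split|]|] => //.
            by move=> [i j] /=; rewrite -{1}sE mxE.
          by move=> A SA x; exact: KE.
        move=> [[[sE KE] QE] ur]; split => //; split; last by move=> A x SA; exact: KE.
        apply/matrixP => i j; rewrite mxE; apply/eqP.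
        by rewrite eq_le (sE (i, j)) (sE (j, i)).
      do 3?[apply: closedI].
      * by apply: closed_forall => -[i j]; apply: closed_le_continuous; exact: E_ij.
      * apply: closed_forall => A; apply: closed_forall => SA; apply: closed_forall => x.
        apply: closed_le_continuous => [u|]; [exact: cst_continuous|].
        have -> : (fun u => q (act A (E u)) x) = fun u => (x *m A *m E u *m
          (x *m A)^T) 0 0.
          by apply/funext => u; rewrite q_act.
        exact: PET_ij.
      * by do 2!apply: closed_forall => ?; apply: closed_le_continuous.
      * by apply: closed_le_continuous => // u; exact: cst_continuous.
  - by apply: continuous_subspaceT.
move: u0X; rewrite inE => -[KB QB r0B]; set B := E u0 in KB QB *.
have Bmin B' r : K B' -> (forall A, S A -> Q (act A B') <= r) -> rho u0 <= r.
  move=> KB' QB'; have [rr0|/ltW rr0] := leP r r0; last exact: le_trans rr0.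
  by rewrite -(rhomk B' r) u0min// inE; split; rewrite ?Emk ?rhomk.
exists B; split; first by case: KB.
  move=> x x0; have := KB.2 1%:M x S1; rewrite q_act mulmx1; apply: lt_le_trans.
  by rewrite mulr_gt0// exprn_gt0// normr_gt0.
move=> A SA; rewrite -[LHS]/(act A B); set B' := act A B.
apply/eqP/negPn/negP => BB'.
have d0 : 0 < `|B - B'| by rewrite normr_gt0 subr_eq0 eq_sym.
(* The gain of the midpoint of [B] and [B'] over the minimum. It is uniform in [A'], since undoing
   the action of [A'] enlarges the norm of [B - B'] by at most [c1 ^+ 2]. *)
pose d := 4^-1 * (`|B - B'| / (1 + c1 ^+ 2)) ^+ 2.
have p0 : 0 < 1 + c1 ^+ 2 by rewrite ltr_wpDr ?sqr_ge0.
have : rho u0 <= rho u0 - d.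
  apply: (Bmin (2^-1 *: (B + B'))); first by apply: K_mid => //; exact: K_act.
  move=> A' SA'; rewrite Q_mid.
  have h1 := QB A' SA'.
  have h2 : Q (act A' B') <= rho u0 by rewrite /B' -actM; exact/QB/SM.
  suff : (`|B - B'| / (1 + c1 ^+ 2)) ^+ 2 <= Q (act A' (B - B')) by rewrite /d; lra.
  apply: le_trans (Q_ge _).
  rewrite ler_sqr ?nnegrE ?divr_ge0 ?(ltW p0)// ler_pdivrMr// mulrC.
  have [A2 SA2 A12] := SV SA'.
  have BE : B - B' = act A2 (act A' (B - B')).
    by rewrite -actM (mulmx1C A12) /act trmx1 mulmx1 mul1mx.
  rewrite [in leLHS]BE (le_trans (norm_act _ SA2))// ler_wpM2r// lerDr//.
by rewrite lerDl oppr_ge0 /d leNgt mulr_gt0// exprn_gt0// divr_gt0.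
Qed.
End InvariantForm.

(** * Differentiability from continuous directional derivatives, and Schwarz's theorem *)

Section Calculus.
Variable R : realType.

Lemma MVT_sym (f : R -> R) b :
  (forall t, `|t| <= `|b| -> derivable f t 1) ->
  exists2 c, `|c| <= `|b| & f b - f 0 = derive1 f c * b.
Proof.
move=> df.
have dfI c d : `|c| <= `|b| -> `|d| <= `|b| -> c <= d ->
    exists2 t, `|t| <= `|b| & f d - f c = derive1 f t * (d - c).
  move=> cb db cd.
  have le_b t : t \in `[c, d]%R -> `|t| <= `|b|.
    rewrite in_itv /= => /andP[ct td]; rewrite ler_norml.
    by move: cb db; rewrite !ler_norml => /andP[? ?] /andP[? ?]; apply/andP; split; lra.
  have [||t tcd E] := @MVT_segment R f (derive1 f) c d cd.
  - move=> t /subset_itv_oo_cc/le_b/df ft; rewrite derive1E; exact: DeriveDef.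
  - by apply: derivable_within_continuous => t /le_b/df.
  by exists t => //; exact: le_b.
have [b0|b0] := leP 0 b.
  by have [||t tb E] := dfI 0 b _ _ b0; rewrite ?normr0//; exists t; rewrite // E subr0.
have [||t tb E] := dfI b 0 _ _ (ltW b0); rewrite ?normr0//.
by exists t => //; rewrite -opprB E sub0r mulrN opprK.
Qed.

Lemma derive_line (V W : normedModType R) (f : V -> W) y u t :
  derivable f (y + t *: u) u ->
  is_derive t 1 (fun s : R => f (y + s *: u)) ('D_u f (y + t *: u)).
Proof.
have E : (fun h : R => h^-1 *: (((fun s => f (y + s *: u)) \o shift t) (h *: 1) -
      f (y + t *: u))) =
    (fun h => h^-1 *: ((f \o shift (y + t *: u)) (h *: u) - f (y + t *: u))).
  apply/funext => h /=; congr (_ *: (f _ - _)).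
  by rewrite scalerDl [h *: 1]mulr1 addrCA.
move=> df; have d1 : derivable (fun s : R => f (y + s *: u)) t 1 by rewrite /derivable E.
by apply: (DeriveDef d1); rewrite /derive E.
Qed.

Lemma growth_rate_shift (V W : normedModType R) (f : V -> W) y u a :
  (fun h : R => h^-1 *: (((fun z => f (z + a)) \o shift y) (h *: u) - f (y + a))) =
  (fun h => h^-1 *: ((f \o shift (y + a)) (h *: u) - f (y + a))).
Proof. by apply/funext => h /=; rewrite addrA. Qed.

Lemma derive_shift_pt (V W : normedModType R) (f : V -> W) y u a :
  'D_u (fun z => f (z + a)) y = 'D_u f (y + a).
Proof. by rewrite /derive growth_rate_shift. Qed.

Lemma derivable_shift_pt (V W : normedModType R) (f : V -> W) y u a :
  derivable f (y + a) u -> derivable (fun z => f (z + a)) y u.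
Proof. by rewrite /derivable growth_rate_shift. Qed.

Lemma MVT_dir (V : normedModType R) (f : V -> R) y u b :
  (forall t, `|t| <= `|b| -> derivable f (y + t *: u) u) ->
  exists2 c, `|c| <= `|b| & f (y + b *: u) - f y = b * 'D_u f (y + c *: u).
Proof.
move=> df; have d (t : R) : `|t| <= `|b| -> is_derive t 1 (fun s : R => f
  (y + s *: u)) ('D_u f (y + t *: u)).
  by move=> /df; exact: derive_line.
have [|c cb] := @MVT_sym (fun s => f (y + s *: u)) b; first by move=> t /d[].
rewrite scale0r addr0 derive1E => ->; exists c => //.
by have [_ ->] := d c cb; rewrite mulrC.
Qed.

Lemma near_norm_lt (V : normedModType R) (P : V -> Prop) x :
  (\forall y \near x, P y) -> exists2 r, 0 < r & forall y, `|y - x| < r -> P y.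
Proof.
move=> /nbhs_ballP[r /= r0 rP]; exists r => // y yx; apply: rP.
by rewrite -ball_normE /ball_ /= distrC.
Qed.

Lemma differentiable_eps (V W : normedModType R) (f : V -> W) (df : {linear V -> W}) x :
  continuous df ->
  (forall e, 0 < e -> \forall h \near 0, `|f (h + x) - f x - df h| <= e * `|h|) ->
  differentiable f x.
Proof.
move=> cdf fdf.
have E : f \o shift x = cst (f x) + df +o_ 0 id.
  apply/eqaddoP => e e0; have := fdf e e0; apply: filterS => h.
  by rewrite /= opprD addrA.
by apply/diff_locallyP; rewrite (diff_unique cdf E).
Qed.

(** Passage from the directional derivatives supplied by [Ck] to Frechet differentiability, which
    the chain rule needs: move from [x] to [h + x] one coordinate at a time and use the mean value
    theorem on each leg. *)
Lemma C1_differentiable m n (f : 'rV[R]_m -> 'rV[R]_n) x :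
  (\forall y \near x, forall v, derivable f y v) ->
  (forall v, {for x, continuous ('D_v f)}) ->
  differentiable f x.
Proof.
move=> df cf.
pose d (h : 'rV[R]_m) := \sum_i h 0 i *: 'D_(delta_mx 0 i) f x.
have dlin : linear d.
  move=> a h h'; rewrite /d scaler_sumr -big_split; apply: eq_bigr => i _ /=.
  by rewrite !mxE scalerDl scalerA.
pose dL := GRing.isLinear.Build _ _ _ _ _ dlin.
pose df0 : {linear 'rV[R]_m -> 'rV[R]_n} := HB.pack d dL.
apply: (@differentiable_eps _ _ _ df0); first exact: linear_rV_continuous.
move=> e e0.
(* One more than the number of legs, so that the division is legitimate for [m = 0]. *)
pose e' := e / m.+1%:R.
have e'0 : 0 < e' by rewrite divr_gt0.
have [r r0 rP] : exists2 r, 0 < r & forall y, `|y - x| < r ->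
    (forall v, derivable f y v) /\
    forall i, `|'D_(delta_mx 0 i) f y - 'D_(delta_mx 0 i) f x| <= e'.
  have : \forall y \near x, (forall v, derivable f y v) /\
      forall i : 'I_m, `|'D_(delta_mx 0 i) f y - 'D_(delta_mx 0 i) f x| <= e'.
    apply: (filterI df).
    apply: (@filter_forall _ 'I_m
      (fun i y => `|'D_(delta_mx 0 i) f y - 'D_(delta_mx 0 i) f x| <= e') (nbhs x)) => i.
    have /cvgrPdist_le/(_ e' e'0) := cf (delta_mx 0 i).
    by move=> h; apply: filterS h => y h; rewrite distrC.
  exact: near_norm_lt.
apply/nbhs_ballP; exists r => //= h; rewrite -ball_normE /ball_ /= sub0r normrN => hr.
(* The corners of the path: [P k] keeps the first [k] coordinates of [h]. *)
pose P k : 'rV[R]_m := \row_i (if (i < k)%N then h 0 i else 0).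
have PS (i : 'I_m) : P i.+1 = P i + h 0 i *: delta_mx 0 i.
  apply/rowP => l; rewrite !mxE eqxx /= ltnS leq_eqVlt (inj_eq val_inj).
  have [->|li] := eqVneq l i; first by rewrite ltnn mulr1 add0r.
  by rewrite mulr0 addr0.
have Pr k c i : `|c| <= `|h 0 i| -> (k <= i)%N -> `|P k + c *: delta_mx 0 i| <= `|h|.
  move=> ch ki; apply: mx_norm_le => // a j; rewrite (ord1 a) !mxE eqxx /=.
  have [->|ji] := eqVneq j i; last by rewrite mulr0 addr0; case: ifP;
    rewrite ?normr0// coord_le_norm.
  by rewrite ltnNge ki /= add0r mulr1 (le_trans ch)// coord_le_norm.
have P0 : P 0%N = 0 by apply/rowP => i; rewrite !mxE.
have Pm : P m = h by apply/rowP => i; rewrite !mxE ltn_ord.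
have tel : f (h + x) - f x - df0 h = \sum_(i < m)
    (f (P i.+1 + x) - f (P i + x) - h 0 i *: 'D_(delta_mx 0 i) f x).
  rewrite sumrB; congr (_ - _).
  have := telescope_sumr (fun k => f (P k + x)) (leq0n m).
  by rewrite big_mkord /= Pm P0 add0r => ->.
rewrite tel; apply: mx_norm_le => [|a j]; first by rewrite mulr_ge0// ltW.
rewrite (ord1 a) summxE (le_trans (ler_norm_sum _ _ _))//.
have -> : e * `|h| = \sum_(i < m.+1) e' * `|h|.
  rewrite sumr_const card_ord -[RHS]mulr_natl mulrA [_%:R * _]mulrC.
  by rewrite divfK ?pnatr_eq0.
rewrite big_ord_recr /= ler_wpDr ?mulr_ge0 ?(ltW e0) ?(ltW e'0) ?invr_ge0 ?ler0n//.
apply: ler_sum => i _.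
have near_x c : `|c| <= `|h 0 i| -> `|P i + x + c *: delta_mx 0 i - x| < r.
  by move=> ch; rewrite addrAC addrK (le_lt_trans _ hr)// Pr.
have [c ch E] := @MVT_dir _ (fun z => f z 0 j) (P i + x) (delta_mx 0 i) (h 0 i)
    (fun t th => (derivable_mxP _ _ _).1 ((rP _ (near_x t th)).1 _) 0 j).
have [dc cc] := rP _ (near_x c ch).
rewrite PS [P i + _ + x]addrAC !mxE.
have -> : f (P i + x + h 0 i *: delta_mx 0 i) 0 j - f (P i + x) 0 j =
    h 0 i * ('D_(delta_mx 0 i) f (P i + x + c *: delta_mx 0 i)) 0 j.
  by rewrite E derive_mx// mxE.
rewrite -mulrBr normrM mulrC ler_pM//; last exact: coord_le_norm.
apply: le_trans (cc i); apply: le_trans (coord_le_norm _ 0 j).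
by rewrite !mxE.
Qed.

(** The mean value theorem twice: along [u] for the increment [f (z + s *: v) - f z], then along [v]
    for ['D_u f]. *)
Lemma second_difference (V : normedModType R) (f : V -> R) x u v s :
  (forall a b, `|a| <= `|s| -> `|b| <= `|s| ->
     derivable f (x + a *: u + b *: v) u /\
     derivable ('D_u f) (x + a *: u + b *: v) v) ->
  exists a b, [/\ `|a| <= `|s|, `|b| <= `|s| &
    f (x + s *: u + s *: v) - f (x + s *: u) - (f (x + s *: v) - f x) =
      s * s * 'D_v ('D_u f) (x + a *: u + b *: v)].
Proof.
move=> df.
have df0 a : `|a| <= `|s| -> derivable f (x + a *: u) u.
  move=> as_; have [|+ _] := df a 0 as_; first by rewrite normr0.
  by rewrite scale0r addr0.
have dfs a : `|a| <= `|s| -> derivable (fun z => f (z + s *: v)) (x + a *: u) u.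
  by move=> as_; apply: derivable_shift_pt; have [+ _] := df a s as_ (lexx _); exact.
have [|a as_ E] := @MVT_dir V ((fun z => f (z + s *: v)) \- f) x u s.
  by move=> t ts; apply: derivableB; [exact: dfs|exact: df0].
have [|b bs E'] := @MVT_dir V ('D_u f) (x + a *: u) v s.
  by move=> t ts; have [_ +] := df a t as_ ts; exact.
exists a, b; split=> //; rewrite -mulrA -E'.
rewrite -(derive_shift_pt f (x + a *: u)) -deriveB; [|exact: dfs|exact: df0].
by rewrite -E.
Qed.

Lemma second_difference_eq (f11 f10 f01 f00 k d d' : R) : k != 0 ->
  f11 - f10 - (f01 - f00) = k * d -> f11 - f01 - (f10 - f00) = k * d' -> d = d'.
Proof. by move=> k0 E E'; apply: (mulfI k0); rewrite -E -E'; ring. Qed.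

Lemma ler_dist_half (a b d e : R) :
  `|a - d| <= e / 2 -> `|b - d| <= e / 2 -> `|a - b| <= e.
Proof.
move=> ad bd; apply: le_trans (ler_distD d a b) _.
by rewrite (splitr e) lerD// distrC.
Qed.

(** The second difference is symmetric in [u] and [v], so the two mixed derivatives agree at two
    possibly different points near [x]; continuity closes the gap. *)
Lemma derive_comm_real (V : normedModType R) (f : V -> R) x u v :
  (\forall y \near x, [/\ derivable f y u, derivable f y v,
     derivable ('D_u f) y v & derivable ('D_v f) y u]) ->
  {for x, continuous ('D_v ('D_u f))} -> {for x, continuous ('D_u ('D_v f))} ->
  'D_v ('D_u f) x = 'D_u ('D_v f) x.
Proof.
move=> df cvu cuv; apply/eqP; rewrite -subr_eq0 -normr_le0.
apply/ler_addgt0Pl => e e0; rewrite addr0.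
have e20 : 0 < e / 2 by rewrite divr_gt0.
have [r r0 rP] : exists2 r, 0 < r & forall y, `|y - x| < r ->
    [/\ derivable f y u, derivable f y v, derivable ('D_u f) y v & derivable
      ('D_v f) y u] /\
    (`|'D_v ('D_u f) x - 'D_v ('D_u f) y| <= e / 2 /\
    `|'D_u ('D_v f) x - 'D_u ('D_v f) y| <= e / 2).
  have /cvgrPdist_le/(_ _ e20) h1 := cvu; have /cvgrPdist_le/(_ _ e20) h2 := cuv.
  have : \forall y \near x,
      [/\ derivable f y u, derivable f y v, derivable ('D_u f) y v & derivable
        ('D_v f) y u] /\
      (`|'D_v ('D_u f) x - 'D_v ('D_u f) y| <= e / 2 /\
      `|'D_u ('D_v f) x - 'D_u ('D_v f) y| <= e / 2).
    exact: filterI df (filterI h1 h2).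
  exact: near_norm_lt.
pose s := r / (1 + `|u| + `|v|).
have n0 : 0 < 1 + `|u| + `|v| by rewrite -addrA ltr_pwDl// addr_ge0.
have s0 : 0 < s by rewrite divr_gt0.
have near_x a b : `|a| <= `|s| -> `|b| <= `|s| -> `|x + a *: u + b *: v - x| < r.
  rewrite (gtr0_norm s0) => as_ bs.
  rewrite addrAC [x + _]addrC addrK (le_lt_trans (ler_normD _ _))// !normrZ.
  apply: (@le_lt_trans _ _ (s * (`|u| + `|v|))).
    by rewrite mulrDr lerD// ler_wpM2r.
  rewrite /s mulrAC ltr_pdivrMr// ltr_pM2l// -addrA ltrDr//.
have [|a [b [as_ bs E]]] := @second_difference V f x u v s.
  move=> a b as_ bs; have [[h1 _ h2 _] _] := rP _ (near_x a b as_ bs).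
  exact: conj h1 h2.
have near_x' b' a' : `|b'| <= `|s| -> `|a'| <= `|s| -> `|x + b' *: v + a' *: u - x| < r.
  move=> bs' as_'; have E' : x + b' *: v + a' *: u = x + a' *: u + b' *: v :=
    addrAC _ _ _.
  exact: (eq_ind_r (fun z => is_true (`|z - x| < r)) (near_x a' b' as_' bs') E').
have [|b' [a' [bs' as_' E']]] := @second_difference V f x v u s.
  move=> b' a' bs' as_'.
  have [[_ h1 _ h2] _] := rP _ (near_x' b' a' bs' as_').
  exact: conj h1 h2.
have fE : f (x + s *: v + s *: u) = f (x + s *: u + s *: v) := congr1 f (addrAC _ _ _).
rewrite fE in E'.
have s20 : s * s != 0 by rewrite mulf_neq0 ?gt_eqF.
have EE := second_difference_eq s20 E E'.
have [_ [h1 _]] := rP _ (near_x a b as_ bs).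
have [_ [_ h2]] := rP _ (near_x' b' a' bs' as_').
by rewrite -EE in h2; exact: ler_dist_half h1 h2.
Qed.

Lemma near_eq_continuous (T U : topologicalType) (f g : T -> U) x :
  (\forall y \near x, f y = g y) -> {for x, continuous f} -> {for x, continuous g}.
Proof.
move=> fg cf; have fgx : f x = g x := nbhs_singleton fg.
have : f @ x --> f x := cf; rewrite fgx => cfg.
by apply: (cvg_trans _ cfg); exact: near_eq_cvg.
Qed.

Lemma derive_coord (V : normedModType R) n (f : V -> 'rV[R]_n) x u j :
  derivable f x u -> 'D_u (fun z => f z 0 j) x = 'D_u f x 0 j.
Proof. by move=> df; rewrite derive_mx// mxE. Qed.

Lemma derive_comm (V : normedModType R) n (f : V -> 'rV[R]_n) x u v :
  (\forall y \near x, [/\ derivable f y u, derivable f y v,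
     derivable ('D_u f) y v & derivable ('D_v f) y u]) ->
  {for x, continuous ('D_v ('D_u f))} -> {for x, continuous ('D_u ('D_v f))} ->
  'D_v ('D_u f) x = 'D_u ('D_v f) x.
Proof.
move=> df cvu cuv; apply/rowP => j.
pose fj z := f z 0 j.
have coord_d (h : V -> 'rV[R]_n) y w : derivable h y w -> derivable
  (fun z => h z 0 j) y w.
  by move=> /derivable_mxP.
have D1 w : (\forall y \near x, derivable f y w) ->
    \forall y \near x, 'D_w f y 0 j = 'D_w fj y.
  by apply: filterS => y dy; rewrite derive_coord.
have dfu : \forall y \near x, derivable f y u by apply: filterS df => y [].
have dfv : \forall y \near x, derivable f y v by apply: filterS df => y [].
have near2 w w' : (\forall y \near x, derivable f y w) ->
    (\forall y \near x, derivable ('D_w f) y w') ->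
    (\forall y \near x, derivable ('D_w fj) y w') /\
    \forall y \near x, 'D_w' ('D_w f) y 0 j = 'D_w' ('D_w fj) y.
  move=> dw dw'.
  have := near_join (D1 w dw) => E; split.
    apply: (filterS _ (filterI E dw')) => y [Ey dy].
    exact: (near_eq_derivable Ey (coord_d _ _ _ dy)).
  apply: (filterS _ (filterI E dw')) => y [Ey dy].
  by rewrite -derive_coord//; exact: (near_eq_derive _ Ey).
have [|du Eu] := near2 u v dfu; first by apply: filterS df => y [].
have [|dv Ev] := near2 v u dfv; first by apply: filterS df => y [].
have cc (h : V -> 'rV[R]_n) : {for x, continuous h} -> {for x, continuous
  (fun z => h z 0 j)}.
  move=> ch.
  exact: (@continuous_comp _ _ _ h (fun A : 'rV[R]_n => A 0 j) x ch
    (@coord_continuous R 1 n 0 j _)).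
have Eux : 'D_v ('D_u f) x 0 j = 'D_v ('D_u fj) x := nbhs_singleton Eu.
have Evx : 'D_u ('D_v f) x 0 j = 'D_u ('D_v fj) x := nbhs_singleton Ev.
apply: (etrans Eux (etrans _ (esym Evx))); apply: derive_comm_real.
- apply: (filterS _ (filterI dfu (filterI dfv (filterI du dv)))) => y [h1 [h2 [h3 h4]]].
  by split; [exact: coord_d h1|exact: coord_d h2|exact: h3|exact: h4].
- exact: near_eq_continuous Eu (cc _ cvu).
- exact: near_eq_continuous Ev (cc _ cuv).
Qed.
End Calculus.

(** * The adjoint representation in a chart *)

Section Slices.
Variables (R : realType) (V1 V2 W : normedModType R).
Implicit Type F : V1 * V2 -> W.

Lemma derive_slice1 F p q u :
  'D_u (fun p => F (p, q)) p = 'D_(u, 0) F (p, q).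
Proof.
have E : (fun h : R => h^-1 *: (((fun p => F (p, q)) \o shift p) (h *: u) - F (p, q))) =
    (fun h => h^-1 *: ((F \o shift (p, q)) (h *: (u, 0)) - F (p, q))).
  apply/funext => h /=; congr (_ *: (F _ - _)).
  by congr pair; rewrite /= scaler0 add0r.
by rewrite /derive E.
Qed.

Lemma derivable_slice1 F p q u :
  derivable F (p, q) (u, 0) -> derivable (fun p => F (p, q)) p u.
Proof.
have E : (fun h : R => h^-1 *: (((fun p => F (p, q)) \o shift p) (h *: u) - F (p, q))) =
    (fun h => h^-1 *: ((F \o shift (p, q)) (h *: (u, 0)) - F (p, q))).
  apply/funext => h /=; congr (_ *: (F _ - _)).
  by congr pair; rewrite /= scaler0 add0r.
by rewrite /derivable E.
Qed.

Lemma derive_slice2 F p q u :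
  'D_u (fun q => F (p, q)) q = 'D_(0, u) F (p, q).
Proof.
have E : (fun h : R => h^-1 *: (((fun q => F (p, q)) \o shift q) (h *: u) - F (p, q))) =
    (fun h => h^-1 *: ((F \o shift (p, q)) (h *: (0, u)) - F (p, q))).
  apply/funext => h /=; congr (_ *: (F _ - _)).
  by congr pair; rewrite /= scaler0 add0r.
by rewrite /derive E.
Qed.

Lemma derivable_slice2 F p q u :
  derivable F (p, q) (0, u) -> derivable (fun q => F (p, q)) q u.
Proof.
have E : (fun h : R => h^-1 *: (((fun q => F (p, q)) \o shift q) (h *: u) - F (p, q))) =
    (fun h => h^-1 *: ((F \o shift (p, q)) (h *: (0, u)) - F (p, q))).
  apply/funext => h /=; congr (_ *: (F _ - _)).
  by congr pair; rewrite /= scaler0 add0r.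
by rewrite /derivable E.
Qed.
End Slices.

Section SliceContinuity.
Variables (V1 V2 W : topologicalType).

Lemma slice1_continuous (F : V1 * V2 -> W) p q :
  {for (p, q), continuous F} -> {for p, continuous (fun p => F (p, q))}.
Proof.
move=> cF; apply: (@continuous_comp _ _ _ (fun p => (p, q)) F) => //.
by apply: cvg_pair; [exact: cvg_id|exact: cvg_cst].
Qed.

Lemma slice2_continuous (F : V1 * V2 -> W) p q :
  {for (p, q), continuous F} -> {for q, continuous (fun q => F (p, q))}.
Proof.
move=> cF; apply: (@continuous_comp _ _ _ (fun q => (p, q)) F) => //.
by apply: cvg_pair; [exact: cvg_cst|exact: cvg_id].
Qed.

Lemma near_slice1 (A : set (V1 * V2)) (p : V1) (q : V2) :
  nbhs ((p, q) : V1 * V2) A -> \forall p' \near p, A (p', q).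
Proof.
have c : (fun p' => (p', q)) @ p --> (p, q) by apply: cvg_pair;
  [exact: cvg_id|exact: cvg_cst].
by move=> /c.
Qed.

Lemma near_slice2 (A : set (V1 * V2)) (p : V1) (q : V2) :
  nbhs ((p, q) : V1 * V2) A -> \forall q' \near q, A (p, q').
Proof.
have c : (fun q' => (p, q')) @ q --> (p, q) by apply: cvg_pair;
  [exact: cvg_cst|exact: cvg_id].
by move=> /c.
Qed.
End SliceContinuity.

Section Smooth.
Variables (R : realType) (V W : normedModType R) (U : set V) (f : V -> W).
Hypothesis sf : smooth_on U f.

Lemma smooth_derivable x v : U x -> derivable f x v.
Proof. by move=> Ux; have [_ /(_ v)[+ _]] := sf 1; exact. Qed.

Lemma smooth_derive_continuous x v : U x -> {for x, continuous ('D_v f)}.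
Proof. by move=> Ux; have [_ /(_ v)[_ [+ _]]] := sf 1; exact. Qed.

Lemma smooth_derive_derivable x v w : U x -> derivable ('D_v f) x w.
Proof. by move=> Ux; have [_ /(_ v)[_ [_ /(_ w)[+ _]]]] := sf 2; exact. Qed.

Lemma smooth_derive2_continuous x v w : U x -> {for x, continuous ('D_w ('D_v f))}.
Proof. by move=> Ux; have [_ /(_ v)[_ [_ /(_ w)[_ [+ _]]]]] := sf 2; exact. Qed.
End Smooth.

Lemma near_eq_differentiable (R : realType) (V W : normedModType R) (f g : V -> W) x :
  (\forall y \near x, f y = g y) -> differentiable f x -> differentiable g x.
Proof.
move=> fg df; have cdf := diff_continuous df.
apply: (differentiable_eps cdf) => e e0.
have /eqaddoP/(_ e e0) := diff_locally df.
have fg0 : \forall h \near (0 : V), f (h + x) = g (h + x).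
  by move: fg; rewrite (near_shift 0 x); apply: filterS => h /=; rewrite subr0.
move/(filterI fg0); apply: filterS => h [/= <-].
by rewrite (nbhs_singleton fg) /= opprD addrA.
Qed.

(** * The multiplication read in charts *)

Section Charts.
Variables (R : realType) (n : nat) (G : lieGroupType R n).
Implicit Types a b c : chart R n G.

Lemma chart_im_map a x : chart_dom a x -> chart_im a (chart_map a x).
Proof. by move=> ax; exists x. Qed.

Lemma chart_invK a p : chart_im a p -> chart_map a (chart_inv a p) = p.
Proof. by move=> [x ax <-]; rewrite chart_mapK. Qed.

Lemma chart_inv_dom a p : chart_im a p -> chart_dom a (chart_inv a p).
Proof. by move=> [x ax <-]; rewrite chart_mapK. Qed.

Definition mul_dom a b c : set ('rV[R]_n * 'rV[R]_n) :=
  [set p | [/\ chart_im a p.1, chart_im b p.2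
    & chart_dom c (chart_inv a p.1 * chart_inv b p.2)%g]].

(** Three independent charts, because conjugation by an element far from 1 passes through charts at
    that element and at its inverse. *)
Definition mul_map a b c (p : 'rV[R]_n * 'rV[R]_n) :=
  chart_map c (chart_inv a p.1 * chart_inv b p.2)%g.

Lemma mul_dom_open a b c p : mul_dom a b c p -> nbhs p (mul_dom a b c).
Proof.
case: p => p q [/= ap bq cpq].
have nap : nbhs p (chart_im a) by apply: open_nbhs_nbhs; split => //;
  exact: chart_im_open.
have nbq : nbhs q (chart_im b) by apply: open_nbhs_nbhs; split => //;
  exact: chart_im_open.
have ap' : \forall z \near (p, q), chart_im a z.1 by exact: (cvg_fst nap).
have bq' : \forall z \near (p, q), chart_im b z.2 by exact: (cvg_snd nbq).
have cm : (fun z : 'rV[R]_n * 'rV[R]_n =>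
  (chart_inv a z.1 * chart_inv b z.2)%g) @ (p, q) -->
    (chart_inv a p * chart_inv b q)%g.
  apply: (@continuous_comp _ _ _ (fun z : 'rV[R]_n * 'rV[R]_n =>
    (chart_inv a z.1, chart_inv b z.2))
    (fun xy : G * G => (xy.1 * xy.2)%g) (p, q)); last exact: lie_mul_continuous.
  apply: cvg_pair.
    by apply: (@continuous_comp _ _ _ fst (chart_inv a) (p, q));
      [exact: cvg_fst|exact: chart_inv_continuous].
  by apply: (@continuous_comp _ _ _ snd (chart_inv b) (p, q));
    [exact: cvg_snd|exact: chart_inv_continuous].
have cpq' := cm _ (open_nbhs_nbhs (conj (chart_dom_open c) cpq)).
by apply: filterS (filterI ap' (filterI bq' cpq')) => z [? [? ?]]; split.
Qed.

Variables (a b c : chart R n G).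
Hypotheses (aA : atlas a) (bA : atlas b) (cA : atlas c).

Lemma mul_map_smooth : smooth_on (mul_dom a b c) (mul_map a b c).
Proof. exact: lie_mul_smooth. Qed.

Lemma mul_map_differentiable1 p q : mul_dom a b c (p, q) ->
  differentiable (fun p => mul_map a b c (p, q)) p.
Proof.
move=> pq; apply: C1_differentiable => [|v].
  apply: filterS (near_slice1 (mul_dom_open pq)) => p' p'q v.
  exact/derivable_slice1/(smooth_derivable mul_map_smooth).
have -> : 'D_v (fun p => mul_map a b c (p, q)) = fun p => 'D_(v, 0)
  (mul_map a b c) (p, q).
  by apply/funext => p'; rewrite derive_slice1.
apply: (slice1_continuous (F := 'D_(v, 0) (mul_map a b c))).
exact: (smooth_derive_continuous mul_map_smooth).
Qed.

Lemma mul_map_differentiable2 p q : mul_dom a b c (p, q) ->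
  differentiable (fun q => mul_map a b c (p, q)) q.
Proof.
move=> pq; apply: C1_differentiable => [|v].
  apply: filterS (near_slice2 (mul_dom_open pq)) => q' pq' v.
  exact/derivable_slice2/(smooth_derivable mul_map_smooth).
have -> : 'D_v (fun q => mul_map a b c (p, q)) = fun q => 'D_(0, v)
  (mul_map a b c) (p, q).
  by apply/funext => q'; rewrite derive_slice2.
apply: (slice2_continuous (F := 'D_(0, v) (mul_map a b c))).
exact: (smooth_derive_continuous mul_map_smooth).
Qed.

Lemma derive_mul_map_differentiable1 p q v : mul_dom a b c (p, q) ->
  differentiable (fun p => 'D_v (mul_map a b c) (p, q)) p.
Proof.
move=> pq; apply: C1_differentiable => [|w].
  apply: filterS (near_slice1 (mul_dom_open pq)) => p' p'q w.
  apply: (derivable_slice1 (F := 'D_v (mul_map a b c))).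
  exact: (smooth_derive_derivable mul_map_smooth).
have -> : 'D_w (fun p => 'D_v (mul_map a b c) (p, q)) =
    fun p => 'D_(w, 0) ('D_v (mul_map a b c)) (p, q).
  by apply/funext => p'; rewrite (derive_slice1 ('D_v (mul_map a b c))).
apply: (slice1_continuous (F := 'D_(w, 0) ('D_v (mul_map a b c)))).
exact: (smooth_derive2_continuous mul_map_smooth).
Qed.

Lemma derive_mul_map_differentiable2 p q v : mul_dom a b c (p, q) ->
  differentiable (fun q => 'D_v (mul_map a b c) (p, q)) q.
Proof.
move=> pq; apply: C1_differentiable => [|w].
  apply: filterS (near_slice2 (mul_dom_open pq)) => q' pq' w.
  apply: (derivable_slice2 (F := 'D_v (mul_map a b c))).
  exact: (smooth_derive_derivable mul_map_smooth).
have -> : 'D_w (fun q => 'D_v (mul_map a b c) (p, q)) =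
    fun q => 'D_(0, w) ('D_v (mul_map a b c)) (p, q).
  by apply/funext => q'; rewrite (derive_slice2 ('D_v (mul_map a b c))).
apply: (slice2_continuous (F := 'D_(0, w) ('D_v (mul_map a b c)))).
exact: (smooth_derive2_continuous mul_map_smooth).
Qed.

Lemma mul_map_derive_comm p u v : mul_dom a b c p ->
  'D_v ('D_u (mul_map a b c)) p = 'D_u ('D_v (mul_map a b c)) p.
Proof.
move=> dp; apply: derive_comm.
- apply: filterS (mul_dom_open dp) => z dz.
  split; [exact: (smooth_derivable mul_map_smooth)|exact:
    (smooth_derivable mul_map_smooth)|
    exact: (smooth_derive_derivable mul_map_smooth)|exact:
      (smooth_derive_derivable mul_map_smooth)].
- exact: (smooth_derive2_continuous mul_map_smooth).
- exact: (smooth_derive2_continuous mul_map_smooth).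
Qed.
End Charts.

Lemma derive_comp (R : realType) (V1 V2 V3 : normedModType R) (f : V1 -> V2)
    (h : V2 -> V3) x v : differentiable f x -> differentiable h (f x) ->
  'D_v (h \o f) x = 'D_('D_v f x) h (f x).
Proof.
move=> df dh; rewrite deriveE; last exact: differentiable_comp.
by rewrite diff_comp//= -(deriveE v df) -(deriveE _ dh).
Qed.

(** * Translations, the bracket and Ad at the identity *)

Section Adjoint.
Variables (R : realType) (n : nat) (G : lieGroupType R n) (phi : chart R n G).
Hypotheses (phi_atlas : atlas phi) (phi_1 : chart_dom phi 1%g).
Local Notation g := 'rV[R]_n.
Local Notation e := (chart_map phi 1%g).
Local Notation inv := (chart_inv phi).
Local Notation m := (mul_map phi phi phi).
Implicit Types (p q X Y Z : g) (x y : G).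

Lemma cvg_mulg (T : Type) (F : set_system T) {FF : Filter F} (f h : T -> G) x y :
  f @ F --> x -> h @ F --> y -> (fun t => f t * h t)%g @ F --> (x * y)%g.
Proof.
move=> fx hy; have fhxy : (fun t => (f t, h t)) @ F --> (x, y).
  exact: cvg_pair fx hy.
have cm : (fun xy : G * G => (xy.1 * xy.2)%g) @ (x, y) -->
  (x * y)%g := lie_mul_continuous (x, y).
exact: (@cvg_comp _ _ _ (fun t => (f t, h t)) (fun xy : G * G =>
  (xy.1 * xy.2)%g) _ _ _ fhxy cm).
Qed.

Lemma im_e : chart_im phi e. Proof. exact: chart_im_map. Qed.
Lemma inv_e : inv e = 1%g. Proof. exact: chart_mapK. Qed.

Lemma mul_dom_pe p : chart_im phi p -> mul_dom phi phi phi (p, e).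
Proof. by move=> pim; split => //=; [exact: im_e|rewrite inv_e mulg1;
  exact: chart_inv_dom]. Qed.

Lemma mul_dom_ep p : chart_im phi p -> mul_dom phi phi phi (e, p).
Proof. by move=> pim; split => //=; [exact: im_e|rewrite inv_e mul1g;
  exact: chart_inv_dom]. Qed.

Lemma near_chart_im p : chart_im phi p -> \forall q \near p, chart_im phi q.
Proof. by move=> pim; apply: open_nbhs_nbhs; split => //; exact: chart_im_open. Qed.

Lemma mul_map_e q : chart_im phi q -> m (e, q) = q.
Proof. by move=> qim; rewrite /mul_map /= inv_e mul1g chart_invK. Qed.

Lemma mul_map_e2 q : chart_im phi q -> m (q, e) = q.
Proof. by move=> qim; rewrite /mul_map /= inv_e mulg1 chart_invK. Qed.

(* The differentials at the identity of the left and right translations by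
   the group element with coordinates [p]. *)
Definition ladv p Y : g := 'D_(0, Y) m (p, e).
Definition radv p Y : g := 'D_(Y, 0) m (e, p).

Lemma radvE p Y : chart_im phi p -> radv p Y = 'd (fun q => m (q, p)) e Y.
Proof.
move=> pim; rewrite -deriveE ?derive_slice1//.
exact: mul_map_differentiable1 (mul_dom_ep pim).
Qed.

Lemma ladv_e Y : ladv e Y = Y.
Proof.
rewrite /ladv -derive_slice2 -[RHS](derive_id e Y); apply: near_eq_derive.
exact: filterS mul_map_e (near_chart_im im_e).
Qed.

Lemma radv_e Y : radv e Y = Y.
Proof.
rewrite /radv -derive_slice1 -[RHS](derive_id e Y); apply: near_eq_derive.
exact: filterS mul_map_e2 (near_chart_im im_e).
Qed.

Lemma ladv_differentiable Y : differentiable (fun p => ladv p Y) e.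
Proof. exact: derive_mul_map_differentiable1 (mul_dom_pe im_e). Qed.

Lemma radv_differentiable Y : differentiable (fun p => radv p Y) e.
Proof. exact: derive_mul_map_differentiable2 (mul_dom_ep im_e). Qed.

(** By [radv_Ad] this is [radv p] applied to [Ad (inv p) Z - Z]; as [radv] is the identity at [e],
    its derivative there is that of Ad. *)
Definition adv Z p : g := ladv p Z - radv p Z.

Lemma adv_differentiable Z : differentiable (adv Z) e.
Proof. exact: differentiableB (ladv_differentiable Z) (radv_differentiable Z). Qed.

Lemma adv_e Z : adv Z e = 0.
Proof. by rewrite /adv ladv_e radv_e subrr. Qed.

(** The second term of the bracket of left-invariant fields is a mixed second derivative of [m] at
    [(e, e)]. Exchanging the order of derivation turns it into the derivative of [radv]. *)
Lemma lie_bracketE X Y : lie_bracket phi X Y = 'D_X (adv Y) e.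
Proof.
have lE Z : left_inv_field phi Z = fun p => ladv p Z.
  by apply/funext => p; rewrite /left_inv_field /ladv -derive_slice2.
have E : 'D_Y (fun p => ladv p X) e = 'D_X (fun p => radv p Y) e.
  rewrite /ladv /radv (derive_slice1 ('D_(0, X) m)) (derive_slice2 ('D_(Y, 0) m)).
  exact: (mul_map_derive_comm phi_atlas phi_atlas phi_atlas _ _ (mul_dom_pe im_e)).
rewrite /lie_bracket /field_bracket !lE !ladv_e.
apply: (etrans (congr1 (fun z => 'D_X (fun p => ladv p Y) e - z) E)).
apply: esym; apply: deriveB.
- exact: diff_derivable (ladv_differentiable Y).
- exact: diff_derivable (radv_differentiable Y).
Qed.

Lemma lie_bracketA X Y : lie_bracket phi Y X = - lie_bracket phi X Y.
Proof. by rewrite /lie_bracket /field_bracket opprB. Qed.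

Lemma lie_bracket_lin a X Y Z :
  lie_bracket phi (a *: X + Y) Z = a *: lie_bracket phi X Z + lie_bracket phi Y Z.
Proof.
rewrite !lie_bracketE !(deriveE _ (adv_differentiable Z)).
exact: linearP.
Qed.

Definition conj_map x q : g := chart_map phi (x * inv q * x^-1)%g.

Lemma conj_map_e x : conj_map x e = e.
Proof. by rewrite /conj_map inv_e mulg1 mulgV. Qed.

Lemma near_conj_dom x : \forall q \near e, chart_dom phi (x * inv q * x^-1)%g.
Proof.
have ci : inv @ e --> (1%g : G) by rewrite -{2}inv_e; exact: (chart_inv_continuous im_e).
have c1 : (fun q => x * inv q)%g @ e --> (x * 1)%g.
  by apply: cvg_mulg ci; exact: cvg_cst.
have c2 : (fun q => x * inv q * x^-1)%g @ e --> (x * 1 * x^-1)%g.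
  by apply: cvg_mulg c1 _; exact: cvg_cst.
rewrite mulg1 mulgV in c2; apply: c2; apply: open_nbhs_nbhs; split => //.
exact: chart_dom_open.
Qed.

Lemma conj_map_inv x : \forall q \near e, inv (conj_map x q) = (x * inv q * x^-1)%g.
Proof. by apply: filterS (near_conj_dom x) => q; exact: chart_mapK. Qed.

(** Left translation by [x] goes from [phi] into a chart [a] at [x]; right translation by the
    inverse, read in a chart [b], comes back to [phi]. *)
Lemma conj_map_differentiable x : differentiable (conj_map x) e.
Proof.
have [a aA ax] := @atlas_cover R n G x.
have [b bA bx] := @atlas_cover R n G x^-1%g.
pose f1 q := mul_map a phi a (chart_map a x, q).
pose f2 q := mul_map a b phi (q, chart_map b x^-1%g).
have dom1 : mul_dom a phi a (chart_map a x, e).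
  by split => /=; rewrite ?chart_mapK ?mulg1//; [exact: chart_im_map|exact: im_e].
have f1e : f1 e = chart_map a x by rewrite /f1 /mul_map /= !chart_mapK ?mulg1.
have dom2 : mul_dom a b phi (f1 e, chart_map b x^-1%g).
  rewrite f1e; split => /=; rewrite ?chart_mapK ?mulgV//; exact: chart_im_map.
have d1 : differentiable f1 e by exact: mul_map_differentiable2.
have d2 : differentiable f2 (f1 e) by exact: mul_map_differentiable1.
apply: (near_eq_differentiable _ (differentiable_comp d1 d2)).
apply: filterS (near_slice2 (mul_dom_open dom1)) => q [_ /= _].
rewrite chart_mapK// => dq.
by rewrite /f2 /f1 /mul_map /= !chart_mapK.
Qed.

Definition Ad x Y : g := 'D_Y (conj_map x) e.

Lemma AdE x Y : Ad x Y = 'd (conj_map x) e Y.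
Proof. exact: deriveE (conj_map_differentiable x). Qed.

Lemma Ad_lin x a Y Z : Ad x (a *: Y + Z) = a *: Ad x Y + Ad x Z.
Proof. by rewrite !AdE; exact: linearP. Qed.

Lemma Ad1 Y : Ad 1%g Y = Y.
Proof.
rewrite /Ad -[RHS](derive_id e Y); apply: near_eq_derive.
apply: filterS (near_chart_im im_e) => q qim.
by rewrite /conj_map mul1g invg1 mulg1 chart_invK.
Qed.

Lemma AdM x y Y : Ad (x * y)%g Y = Ad x (Ad y Y).
Proof.
have dx : differentiable (conj_map x) (conj_map y e).
  by rewrite conj_map_e; exact: conj_map_differentiable.
have E : \forall q \near e, conj_map (x * y)%g q = (conj_map x \o conj_map y) q.
  apply: filterS (conj_map_inv y) => q qE.
  by rewrite /= /conj_map -/(conj_map y q) qE invgM !mulgA.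
apply: (etrans (near_eq_derive _ E)).
apply: (etrans (derive_comp _ (conj_map_differentiable y) dx)).
by rewrite conj_map_e.
Qed.

(* Conjugation followed by right translation is left translation; this gives
   the derivative of [Ad] without differentiating the inversion. *)
Lemma radv_Ad p Y : chart_im phi p -> radv p (Ad (inv p) Y) = ladv p Y.
Proof.
move=> pim; have dr : differentiable (fun q => m (q, p)) (conj_map (inv p) e).
  by rewrite conj_map_e; exact: mul_map_differentiable1 (mul_dom_ep pim).
have E : \forall q \near e, ((fun q => m (q, p)) \o conj_map (inv p)) q = m (p, q).
  apply: filterS (conj_map_inv (inv p)) => q qE.
  by rewrite /= /mul_map /= qE -mulgA mulVg mulg1.
rewrite /ladv -derive_slice2 /radv -derive_slice1.
apply: (etrans _ (near_eq_derive _ E)).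
apply: (etrans _ (esym (derive_comp _ (conj_map_differentiable _) dr))).
by rewrite conj_map_e.
Qed.
End Adjoint.

(** * A lower bound near the identity and a product rule *)

Section Estimates.
Variable R : realType.

(** Summing over at most [n] coordinates, [T] moves [Y] by at most half its norm. Applied to [radv],
    this bound replaces inverting it. *)
Lemma linear_near_id_lower n (T : {linear 'rV[R]_n -> 'rV[R]_n}) :
  (forall i, `|T (delta_mx 0 i) - delta_mx 0 i| <= (2 * n.+1%:R)^-1) ->
  forall Y, `|Y| <= 2 * `|T Y|.
Proof.
move=> Te Y; set d := (2 * n.+1%:R)^-1 in Te.
have d0 : 0 <= d by rewrite invr_ge0 mulr_ge0.
have TY : `|T Y - Y| <= 2^-1 * `|Y|.
  have -> : T Y - Y = \sum_i Y 0 i *: (T (delta_mx 0 i) - delta_mx 0 i).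
    rewrite {1 2}[Y]row_sum_delta linear_sum -sumrB; apply: eq_bigr => i _.
    by rewrite linearZ scalerBr.
  apply: le_trans (ler_norm_sum _ _ _) _.
  have -> : 2^-1 * `|Y| = \sum_(i < n.+1) `|Y| * d.
    have nd : n.+1%:R * d = 2^-1 by rewrite /d invfM mulrCA mulfV ?mulr1 ?pnatr_eq0.
    by rewrite sumr_const card_ord -[RHS]mulr_natl mulrCA nd mulrC.
  rewrite big_ord_recr /= ler_wpDr ?mulr_ge0//; apply: ler_sum => i _.
  by rewrite normrZ ler_pM// coord_le_norm.
have h : `|Y| <= `|T Y| + 2^-1 * `|Y|.
  rewrite -{1}[Y](subKr (T Y)); apply: le_trans (ler_normB _ _) _.
  by rewrite lerD2l.
lra.
Qed.

Lemma is_derive_at0P (V : normedModType R) (f : R -> V) l :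
  (fun h => h^-1 *: (f h - f 0)) @ 0^' --> l <-> is_derive (0 : R) 1 f l.
Proof.
have E : (fun h : R => h^-1 *: ((f \o shift 0) (h *: 1) - f 0)) =
    (fun h => h^-1 *: (f h - f 0)).
  by apply/funext => h /=; rewrite addr0 [h *: 1]mulr1.
split=> [fl|[df <-]].
  have df : derivable f 0 1 by rewrite /derivable E; apply/cvg_ex; exists l.
  by apply: (DeriveDef df); rewrite /derive E; exact/cvg_lim.
by rewrite /derive E; move: df; rewrite /derivable E.
Qed.

Section Bilinear.
Variables (n : nat) (W : normedModType R) (f : 'rV[R]_n -> 'rV[R]_n -> W).
Hypothesis fl : forall a x y z, f (a *: x + y) z = a *: f x z + f y z.
Hypothesis fr : forall a x y z, f z (a *: x + y) = a *: f z x + f z y.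

Lemma bilin_sum x y :
  f x y = \sum_i \sum_j (x 0 i * y 0 j) *: f (delta_mx 0 i) (delta_mx 0 j).
Proof.
have [L LE] := linear_exists (fun a u v => fl a u v y).
rewrite -LE {1}[x]row_sum_delta linear_sum; apply: eq_bigr => i _.
rewrite linearZ LE /=.
have [L' LE'] := linear_exists (fun a u v => fr a u v (delta_mx 0 i)).
rewrite -LE' {1}[y]row_sum_delta linear_sum scaler_sumr; apply: eq_bigr => j _.
by rewrite linearZ LE' scalerA.
Qed.

Lemma bilin_cvg T (F : set_system T) {FF : Filter F} (a b : T -> 'rV[R]_n) A B :
  a @ F --> A -> b @ F --> B -> (fun t => f (a t) (b t)) @ F --> f A B.
Proof.
move=> aA bB.
have coord (c : T -> 'rV[R]_n) (D : 'rV[R]_n) j : c @ F --> D ->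
  (fun t => c t 0 j) @ F --> D 0 j.
  move=> cD.
  exact: (@cvg_comp _ _ _ c (fun M : 'rV[R]_n => M 0 j) _ _ _ cD
    (@coord_continuous R 1 n 0 j D)).
have sum_cvg I (r : seq I) (s : I -> T -> W) (S : I -> W) :
    (forall i, s i @ F --> S i) ->
    (fun t => \sum_(i <- r) s i t) @ F --> \sum_(i <- r) S i.
  move=> sS; elim: r => [|i r IH].
    by rewrite big_nil; under eq_fun do rewrite big_nil; exact: cvg_cst.
  by rewrite big_cons; under eq_fun do rewrite big_cons; exact: cvgD (sS i) IH.
rewrite bilin_sum; under eq_fun do rewrite bilin_sum.
apply: (sum_cvg) => i; apply: (sum_cvg) => j.
apply: cvgZ; last exact: cvg_cst.
exact: cvgM (coord _ _ _ aA) (coord _ _ _ bB).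
Qed.

Lemma is_derive_bilin (a b : R -> 'rV[R]_n) a' b' :
  is_derive (0 : R) 1 a a' -> is_derive (0 : R) 1 b b' ->
  is_derive (0 : R) 1 (fun t => f (a t) (b t)) (f a' (b 0) + f (a 0) b').
Proof.
move=> da db; apply/is_derive_at0P.
have fBl x y z : f (x - y) z = f x z - f y z.
  by rewrite -scaleN1r addrC fl scaleN1r addrC.
have fBr x y z : f z (x - y) = f z x - f z y.
  by rewrite -scaleN1r addrC fr scaleN1r addrC.
have f0l z : f 0 z = 0 by rewrite -(subrr 0) fBl subrr.
have f0r z : f z 0 = 0 by rewrite -(subrr 0) fBr subrr.
have fZl c x z : f (c *: x) z = c *: f x z by rewrite -[c *: x]addr0 fl f0l addr0.
have fZr c x z : f z (c *: x) = c *: f z x by rewrite -[c *: x]addr0 fr f0r addr0.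
have E : (fun h : R => h^-1 *: (f (a h) (b h) - f (a 0) (b 0))) =
   (fun h => f (h^-1 *: (a h - a 0)) (b h) + f (a 0) (h^-1 *: (b h - b 0))).
  apply/funext => h; rewrite fZl fZr -scalerDr fBl fBr; congr (_ *: _).
  by rewrite addrA subrK.
rewrite E; apply: cvgD.
  apply: bilin_cvg; first by apply/is_derive_at0P.
  have cb : b @ (0 : R) --> b 0.
    by apply/differentiable_continuous/derivable1_diffP; case: db.
  by apply: cvg_trans cb; apply: cvg_fmap2; exact: cvg_within.
apply: bilin_cvg; first exact: cvg_cst.
by apply/is_derive_at0P.
Qed.
End Bilinear.
End Estimates.

Lemma near_cvg (T : Type) (U : topologicalType) (F : set_system T) (f : T -> U)
    (P : U -> Prop) (y : U) : f @ F --> y -> (\forall z \near y, P z) ->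
  \forall t \near F, P (f t).
Proof. by move=> fy Py; exact: (fy _ Py). Qed.

Lemma subrBB (V : zmodType) (a b c : V) : a - b - (c - b) = a - c.
Proof. by rewrite opprB addrA subrK. Qed.

Lemma derive_linear (R : realType) (V W : normedModType R) (L : {linear V -> W}) x v :
  continuous L -> 'D_v L x = L v.
Proof. by move=> cL; rewrite deriveE ?diff_lin//; exact: linear_differentiable. Qed.

(** * Boundedness of Ad, the invariant form and the Jacobi identity *)

Section AdjointBound.
Variables (R : realType) (n : nat) (G : lieGroupType R n) (phi : chart R n G).
Hypotheses (phi_atlas : atlas phi) (phi_1 : chart_dom phi 1%g).
Local Notation g := 'rV[R]_n.
Local Notation e := (chart_map phi 1%g).
Local Notation inv := (chart_inv phi).
Local Notation Ad := (Ad phi).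
Implicit Types (p q X Y Z : g) (x y : G).

Lemma ladv_cvg Y : (fun p => ladv phi p Y) @ e --> Y.
Proof.
rewrite -{2}(ladv_e phi_1 Y).
exact: differentiable_continuous (ladv_differentiable phi_atlas phi_1 Y).
Qed.

Lemma radv_cvg Y : (fun p => radv phi p Y) @ e --> Y.
Proof.
rewrite -{2}(radv_e phi_1 Y).
exact: differentiable_continuous (radv_differentiable phi_atlas phi_1 Y).
Qed.

Lemma radv_lower : \forall p \near e,
  chart_im phi p /\ forall Y, `|Y| <= 2 * `|radv phi p Y|.
Proof.
have d0 : 0 < (2 * n.+1%:R)^-1 :> R by rewrite invr_gt0 mulr_gt0.
have near_d : \forall p \near e, forall i : 'I_n,
    `|radv phi p (delta_mx 0 i) - delta_mx 0 i| <= (2 * n.+1%:R)^-1.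
  apply: (@filter_forall _ 'I_n (fun i p =>
    `|radv phi p (delta_mx 0 i) - delta_mx 0 i| <= (2 * n.+1%:R)^-1) (nbhs e)) => i.
  have /cvgrPdist_le/(_ _ d0) h := @radv_cvg (delta_mx 0 i).
  by apply: (filterS _ h) => p; rewrite distrC.
apply: (filterS _ (filterI (near_chart_im (im_e phi_1)) near_d)) => p [pim pd].
split => // Y; rewrite (radvE phi_atlas phi_1)//.
by apply: linear_near_id_lower => i; rewrite -(radvE phi_atlas phi_1).
Qed.

(** Acts on row vectors from the right, whence the reversed order in [AdmxM]. *)
Definition Admx x : 'M[R]_n := \matrix_i Ad x (delta_mx 0 i).

Lemma mul_Admx Y x : Y *m Admx x = Ad x Y.
Proof.
rewrite mulmx_sum_row {2}[Y]row_sum_delta (AdE phi_atlas) // linear_sum.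
by apply: eq_bigr => i _; rewrite rowK linearZ (AdE phi_atlas).
Qed.

Lemma AdmxM x y : Admx (x * y)%g = Admx y *m Admx x.
Proof.
apply/row_matrixP => i; rewrite row_mul [in RHS]/Admx !rowK.
by rewrite -/(Admx x) mul_Admx (AdM phi_atlas phi_1).
Qed.

Lemma Admx1 : Admx 1%g = 1%:M.
Proof. by apply/row_matrixP => i; rewrite rowK (Ad1 phi_1) rowE mulmx1. Qed.

(** In [radv p (Ad (inv p) Y) = ladv p Y], near the identity [radv] shrinks norms by at most 2 and
    [ladv] sends basis vectors to norm at most 2: hence 4. *)
Lemma near_Admx_le : \forall x \near (1%g : G), `|Admx x| <= 4.
Proof.
have near_l : \forall p \near e, forall i : 'I_n, `|ladv phi p (delta_mx 0 i)| <= 2.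
  apply: (@filter_forall _ 'I_n (fun i p => `|ladv phi p (delta_mx 0 i)| <= 2)
    (nbhs e)) => i.
  have /cvgrPdist_le/(_ _ ltr01) h := @ladv_cvg (delta_mx 0 i).
  apply: (filterS _ h) => p hp.
  rewrite -[ladv _ _ _](subKr (delta_mx 0 i)); apply: le_trans (ler_normB _ _) _.
  have d1 : `|delta_mx 0 i : g| <= 1.
    by apply: mx_norm_le => // a j; rewrite mxE; case: andP => _; rewrite ?normr1 ?normr0.
  by apply: le_trans (lerD d1 hp) _.
have near_A : \forall p \near e, `|Admx (inv p)| <= 4.
  apply: (filterS _ (filterI radv_lower near_l)) => p [[pim plow] pl].
  apply: mx_norm_le => // i j; rewrite mxE.
  apply: le_trans (coord_le_norm _ 0 j) _; apply: le_trans (plow _) _.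
  rewrite (radv_Ad phi_atlas phi_1)//.
  have := pl i; lra.
have near_1 : \forall x \near (1%g : G), chart_dom phi x.
  by apply: open_nbhs_nbhs; split => //; exact: chart_dom_open.
have near_2 : \forall x \near (1%g : G), `|Admx (inv (chart_map phi x))| <= 4.
  exact: (near_cvg (P := fun p => `|Admx (inv p)| <= 4)
    (chart_map_continuous phi_1) near_A).
by apply: (filterS _ (filterI near_1 near_2)) => x [xd]; rewrite chart_mapK.
Qed.

(** Writing x' as x (x^-1 x') transports the bound near 1 to a neighbourhood of any [x]; compactness
    makes the bound uniform. *)
Lemma Admx_bounded : compact [set: G] -> exists M, forall x, `|Admx x| <= M.
Proof.
move=> /compact_near_coveringP G_compact.
have := G_compact R (pinfty_nbhs R) (fun M x => `|Admx x| <= M) _.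
case=> [x _|M [_ HM]].
  pose K := n%:R * 4 * `|Admx x|.
  exists ([set x' | `|Admx x'| <= K], [set M | K <= M]); last first.
    by move=> [x' M] /= [h1 h2]; exact: le_trans h1 h2.
  split; last exact: nbhs_pinfty_ge (num_real _).
  have cx : (fun x' => x^-1 * x')%g @ x --> (1%g : G).
    by rewrite -(mulVg x); apply: cvg_mulg; [exact: cvg_cst|exact: cvg_id].
  have near_x : \forall x' \near x, `|Admx (x^-1 * x')%g| <= 4 
    by exact: (near_cvg (P := fun z => `|Admx z| <= 4) cx near_Admx_le).
  apply: (filterS _ near_x) => x' /= hx'.
  have -> : x' = (x * (x^-1 * x'))%g by rewrite mulgA mulgV mul1g.
  rewrite AdmxM; apply: le_trans (mx_normM _ _) _.
  by rewrite /K ler_wpM2r// ler_wpM2l.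
exists (M + 1) => x; apply: (HM (M + 1)) => //.
by rewrite ltrDl.
Qed.

Lemma invariant_form : compact [set: G] -> exists B : 'M[R]_n,
  [/\ B^T = B, forall X, X != 0 -> 0 < (X *m B *m X^T) 0 0
    & forall x X Y, (Ad x X *m B *m (Ad x Y)^T) 0 0 = (X *m B *m Y^T) 0 0].
Proof.
move=> /Admx_bounded[M AdM_le].
have [||||B [symB posB invB]] := @invariant_form_exists R n (range Admx) M.
- by exists 1%g => //; rewrite Admx1.
- by move=> _ _ [x _ <-] [y _ <-]; exists (y * x)%g => //; rewrite AdmxM.
- move=> _ [x _ <-]; exists (Admx x^-1%g); first by exists x^-1%g.
  by rewrite -AdmxM mulVg Admx1.
- by move=> _ [x _ <-]; exact: AdM_le.
exists B; split=> // x X Y.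
rewrite -!mul_Admx trmx_mul !mulmxA -(mulmxA X) -(mulmxA X).
by rewrite invB//; exists x.
Qed.

(** Applying [radv] to the error of the difference quotient of Ad gives the error for [adv] minus
    [radv l - l]. Both tend to 0, and [radv_lower] carries this back to the quotient itself, at the
    cost of the factor 2 behind [eps / 4]. *)
Lemma Ad_curve (c : R -> g) X Z : c 0 = e -> is_derive (0 : R) 1 c X ->
  is_derive (0 : R) 1 (fun t => Ad (inv (c t)) Z) (lie_bracket phi X Z).
Proof.
move=> c0 dc.
have diffc : differentiable c (0 : R) by apply/derivable1_diffP; case: dc.
have diffa : differentiable (adv phi Z) (c 0) by rewrite c0; exact: adv_differentiable.
set l := lie_bracket phi X Z.
have d1 : (fun h : R => h^-1 *: adv phi Z (c h)) @ 0^' --> l.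
  have dE : is_derive (0 : R) 1 (adv phi Z \o c) l.
    have d : derivable (adv phi Z \o c) (0 : R) 1.
      exact: diff_derivable (differentiable_comp diffc diffa).
    apply: (DeriveDef d); rewrite (derive_comp _ diffc diffa).
    by have [_ ->] := dc; rewrite c0 -(lie_bracketE phi_atlas phi_1).
  have := (is_derive_at0P _ _).2 dE.
  have -> : (fun h : R => h^-1 *: ((adv phi Z \o c) h - (adv phi Z \o c) 0)) =
      (fun h : R => h^-1 *: adv phi Z (c h)) => //.
  by apply/funext => h /=; rewrite c0 (adv_e phi_1) subr0.
have cc : c @ (0 : R)^' --> e.
  have : c @ (0 : R) --> e by rewrite -c0; exact: differentiable_continuous diffc.
  exact: cvg_within_filter.
have d2 : (fun h : R => radv phi (c h) l) @ 0^' --> l.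
  exact: (@cvg_comp _ _ _ c (fun p => radv phi p l) _ _ _ cc (@radv_cvg l)).
have low := near_cvg
  (P := fun p => chart_im phi p /\ forall Y, `|Y| <= 2 * `|radv phi p Y|) cc radv_lower.
apply/is_derive_at0P; rewrite c0 (inv_e phi_1) (Ad1 phi_1).
apply/cvgrPdist_le => eps eps0.
have eps4 : 0 < eps / 4 by rewrite divr_gt0.
have /cvgrPdist_le/(_ _ eps4) h1 := d1.
have /cvgrPdist_le/(_ _ eps4) h2 := d2.
apply: (filterS _ (filterI low (filterI h1 h2))) => h [[pim plow] [h1' h2']].
rewrite distrC; apply: le_trans (plow _) _.
have -> : radv phi (c h) (h^-1 *: (Ad (inv (c h)) Z - Z) - l) =
    (h^-1 *: adv phi Z (c h) - l) - (radv phi (c h) l - l).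
  rewrite (radvE phi_atlas phi_1 _ pim) linearB linearZ linearB /=.
  rewrite -!(radvE phi_atlas phi_1 _ pim) (radv_Ad phi_atlas phi_1 _ pim).
  exact: esym (subrBB _ _ _).
have h3 : `|h^-1 *: adv phi Z (c h) - l - (radv phi (c h) l - l)| <= eps / 4 + eps / 4.
  apply: le_trans (ler_normB _ _) _; rewrite distrC in h1'; rewrite distrC in h2'.
  exact: lerD h1' h2'.
lra.
Qed.

Lemma is_derive_line Y : is_derive (0 : R) 1 (fun t => e + t *: Y) Y.
Proof.
apply/is_derive_at0P.
have E : (fun h : R => h^-1 *: (e + h *: Y - (e + 0 *: Y))) @ 0^' --> Y.
  apply: (@cvg_trans _ (cst Y @ (0 : R)^')); last exact: cvg_cst.
  apply: near_eq_cvg; apply: (filterS _ (nbhs_dnbhs_neq (0 : R))) => h h0.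
  by rewrite scale0r addr0 addrAC subrr add0r scalerA mulVf// scale1r.
exact: E.
Qed.

(** The product rule for the constant function pairing Ad Y with Ad Z along a curve of velocity [X];
    a straight line in the chart suffices, as only its velocity at 0 counts. *)
Lemma invariant_form_bracket (B : 'M[R]_n) :
  (forall x X Y, (Ad x X *m B *m (Ad x Y)^T) 0 0 = (X *m B *m Y^T) 0 0) ->
  forall X Y Z, (lie_bracket phi X Y *m B *m Z^T) 0 0 =
    - (Y *m B *m (lie_bracket phi X Z)^T) 0 0.
Proof.
move=> invB X Y Z.
pose f (Y Z : g) : R := (Y *m B *m Z^T) 0 0.
have fl a (u u' w : g) : f (a *: u + u') w = a *: f u w + f u' w.
  by rewrite /f !mulmxDl -!scalemxAl !mxE.
have fr a (u u' w : g) : f w (a *: u + u') = a *: f w u + f w u'.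
  by rewrite /f linearP /= mulmxDr -scalemxAr !mxE.
have c0 : e + 0 *: X = e by rewrite scale0r addr0.
have dY := Ad_curve Y c0 (is_derive_line X).
have dZ := Ad_curve Z c0 (is_derive_line X).
have := is_derive_bilin fl fr dY dZ.
have -> : (fun t : R => f (Ad (inv (e + t *: X)) Y) (Ad (inv
  (e + t *: X)) Z)) = cst (f Y Z).
  by apply/funext => t; exact: invB.
rewrite c0 (inv_e phi_1) !(Ad1 phi_1) => -[_].
by rewrite derive_cst => /esym/eqP; rewrite addr_eq0 => /eqP.
Qed.

(** Both sides are the derivative at 0 of Ad (x c(t)) Z for c(t) of velocity [Y]: once as Ad x after
    Ad c(t), once as Ad of the conjugated curve applied to Ad x Z. *)
Lemma Ad_bracket x Y Z :
  Ad x (lie_bracket phi Y Z) = lie_bracket phi (Ad x Y) (Ad x Z).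
Proof.
have c0 : e + 0 *: Y = e by rewrite scale0r addr0.
pose c (t : R) := conj_map phi x (e + t *: Y).
have cc0 : c 0 = e by rewrite /c c0 (conj_map_e phi_1).
have dl := is_derive_line Y.
have diffl : differentiable (fun t : R => e + t *: Y) (0 : R).
  by apply/derivable1_diffP; case: dl.
have diffx : differentiable (conj_map phi x) (e + 0 *: Y).
  by rewrite c0; exact: conj_map_differentiable.
have dc : is_derive (0 : R) 1 c (Ad x Y).
  have d : derivable c (0 : R) 1 by exact: diff_derivable
    (differentiable_comp diffl diffx).
  apply: (DeriveDef d); apply: (etrans (derive_comp _ diffl diffx)).
  by have [_ ->] := dl; rewrite c0.
have d1 := Ad_curve (Ad x Z) cc0 dc.
have d2 := Ad_curve Z c0 dl.
have [L LE] := linear_exists (Ad_lin phi_atlas phi_1 x).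
have AdL : Ad x = L by apply/funext => U; rewrite LE.
have diffA : differentiable (Ad x) (Ad (inv (e + 0 *: Y)) Z).
  by rewrite AdL; apply: linear_differentiable; exact: linear_rV_continuous.
have d2' : is_derive (0 : R) 1 (Ad x \o (fun t => Ad (inv (e + t *: Y)) Z))
    (Ad x (lie_bracket phi Y Z)).
  have diff2 : differentiable (fun t : R => Ad (inv (e + t *: Y)) Z) (0 : R).
    by apply/derivable1_diffP; case: d2.
  apply: (DeriveDef (diff_derivable (differentiable_comp diff2 diffA))).
  apply: (etrans (derive_comp _ diff2 diffA)); have [_ ->] := d2.
  by rewrite AdL; apply: derive_linear; exact: linear_rV_continuous.
have E : \forall t \near (0 : R), (Ad x \o (fun t => Ad (inv (e + t *: Y)) Z)) t =
    Ad (inv (c t)) (Ad x Z).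
  have cl : (fun t : R => e + t *: Y) @ (0 : R) --> e.
    by rewrite -{2}c0; exact: differentiable_continuous diffl.
  have near_i := near_cvg
    (P := fun q => inv (conj_map phi x q) = (x * inv q * x^-1)%g) cl
      (conj_map_inv phi_1 x).
  apply: (filterS _ near_i) => t /= ->.
  by rewrite -!(AdM phi_atlas phi_1) -mulgA mulVg mulg1.
have [_ <-] := d2'; have [_ <-] := d1.
exact: near_eq_derive E.
Qed.

(** Differentiating [Ad_bracket] along a line of velocity [X] gives the identity without third
    derivatives of the multiplication. *)
Lemma lie_bracketJ X Y Z : lie_bracket phi X (lie_bracket phi Y Z) =
  lie_bracket phi (lie_bracket phi X Y) Z + lie_bracket phi Y (lie_bracket phi X Z).
Proof.
have bl a U V W := lie_bracket_lin phi_atlas phi_1 a U V W.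
have br a U V W : lie_bracket phi W (a *: U + V) =
    a *: lie_bracket phi W U + lie_bracket phi W V.
  by rewrite (lie_bracketA phi (a *: U + V) W) (lie_bracketA phi U W)
    (lie_bracketA phi V W) bl opprD scalerN.
have c0 : e + 0 *: X = e by rewrite scale0r addr0.
have dl := is_derive_line X.
have d := is_derive_bilin bl br (Ad_curve Y c0 dl) (Ad_curve Z c0 dl).
have [_ E1] := Ad_curve (lie_bracket phi Y Z) c0 dl.
have [_ E2] := d.
rewrite c0 (inv_e phi_1) !(Ad1 phi_1) in E2.
rewrite -E1 -E2; congr ('D_1 _ (0 : R)).
by apply/funext => t; exact: Ad_bracket.
Qed.
End AdjointBound.

Theorem theorem1p1 (R : realType) (k : nat) (G : lieGroupType R k.*2.+1)
    (G_connected : connected [set: G]) (G_compact : compact [set: G])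
    (phi : chart R k.*2.+1 G) (phi_atlas : atlas phi)
    (phi_1 : chart_dom phi 1%g)
    (v : {vspace 'rV[R[i]]_(k.*2.+1)})
    (v_elliptic : elliptic_min_rank (lie_bracket phi) k fullv v) :
  exists t : {vspace 'rV[R]_(k.*2.+1)},
    maximal_abelian (lie_bracket phi) t /\
    exists D : seq (root_form t),
      positive_system (lie_bracket phi) D /\
      let e := (v :&: complexify t)%VS in
      [/\ v = (e + \sum_(a <- D) root_space (lie_bracket phi) a)%VS,
          directv (e + \sum_(a <- D) root_space (lie_bracket phi) a)
        & exists r : nat, \dim t = r.*2.+1 /\
            elliptic_min_rank (lie_bracket phi) r (complexify t) e].
Proof.
have [B [symB posB invB]] := invariant_form phi_atlas phi_1 G_compact.
apply: (@elliptic_of_invariant_form R k (lie_bracket phi)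
  (fun X Y => (X *m B *m Y^T) 0 0)) => //.
- exact: lie_bracket_lin.
- exact: lie_bracketA.
- exact: lie_bracketJ.
- by move=> a x y z; rewrite !mulmxDl -!scalemxAl !mxE.
- move=> x y; have -> : (y *m B *m x^T) = (x *m B *m y^T)^T.
    by rewrite !trmx_mul trmxK symB mulmxA.
  by rewrite mxE.
- exact: invariant_form_bracket.
Qed.
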